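(* Let $d\ge4$, $\nu=d/2-1$. Assume: (1) there is a sequence $0=x_0<x_1<\dots<x_n<x_{n+1}=a_I$ such that for each $i\in\{1,\dots,n\}$, $f_\nu(k_\nu K(x_{i+1})x_{i+1})+K(x_i)^df_\nu(k_\nu b(x_i))\le0$, and $G_1(x_1)+G_2(x_0)\le0$; (2) there is a sequence $a_S=y_0<y_1<\dots<y_m<y_{m+1}=1$ such that for each $i\in\{0,\dots,m-1\}$, $f_\nu(k_\nu K(y_{i+1})y_{i+1})+f_\nu(k_\nu b(y_i))\le0$, and $$2T_1(y_m)-f_\nu(k_\nu b(y_m))\,|g_\nu(k_\nu K(y_m)y_m)|\left[\frac{d-1}{y_m^d}\Big(1+\frac1{b(y_m)}\Big)+1\right]-(f_\nu g_\nu)(k_\nu b(y_m))\ge0.$$ Then for every $a\in[0,a_I)\cup(a_S,1]$, $F_\nu(k_\nu,a):=f_\nu(k_\nu K(a)a)+K(a)^df_\nu(k_\nu b(a))\le0$.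
   Context: $J_\nu,I_\nu$ are the Bessel and modified Bessel functions of the first kind of order $\nu$; $j_{\nu,m}$ is the $m$-th positive zero of $J_\nu$ and $j_\nu=j_{\nu,1}$. $f_\nu(r)=r^{d-1}\big[\frac{J_{\nu+1}(r)}{J_\nu(r)}+\frac{I_{\nu+1}(r)}{I_\nu(r)}\big]$ and $g_\nu(r)=r^{1-d}\big[\frac{J_{\nu+1}(r)}{J_\nu(r)}-\frac{I_{\nu+1}(r)}{I_\nu(r)}\big]$; $k_\nu$ is the first positive zero of $f_\nu$. For $a\in[0,1]$, $b(a)\in[0,1]$ is defined by $a^d+b(a)^d=1$ and $K(a)=a^{d-1}/(1+b(a)^{d-1})$; $K'$ is its derivative. $a_I$ is defined by $b(a_I)=j_\nu/k_\nu$ and $a_S$ by $a_SK(a_S)=j_\nu/k_\nu$. $T_1(a)=(aK(a))^dK'(a)/K(a)$, $G_1(a)=[aK'(a)+K(a)](k_\nu K(a))^{d-1}g_\nu(k_\nu aK(a))$, $G_2(a)=k_\nu^{d-1}g_\nu(k_\nu b(a))$. *)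

(* Defs.v *)
From Stdlib Require Import Reals.
From Coquelicot Require Import Coquelicot.
Open Scope R_scope.

(* real power with the convention x^y = 0 for x <= 0 (used only with y > 0) *)
Definition rpow (x y : R) : R := if Rlt_dec 0 x then Rpower x y else 0.

Definition Gamma (x : R) : R :=
  RInt_gen (fun t => rpow t (x - 1) * exp (- t)) (at_right 0) (Rbar_locally p_infty).

Definition BesselJ (nu r : R) : R :=
  Series (fun k => (-1) ^ k / (INR (Factorial.fact k) * Gamma (INR k + nu + 1))
                   * rpow (r / 2) (2 * INR k + nu)).
Definition BesselI (nu r : R) : R :=
  Series (fun k => / (INR (Factorial.fact k) * Gamma (INR k + nu + 1))
                   * rpow (r / 2) (2 * INR k + nu)).

Definition nu_of (d : nat) : R := INR d / 2 - 1.

Definition f_nu (d : nat) (r : R) : R :=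
  r ^ (d - 1) * (BesselJ (nu_of d + 1) r / BesselJ (nu_of d) r
                 + BesselI (nu_of d + 1) r / BesselI (nu_of d) r).
Definition g_nu (d : nat) (r : R) : R :=
  / r ^ (d - 1) * (BesselJ (nu_of d + 1) r / BesselJ (nu_of d) r
                   - BesselI (nu_of d + 1) r / BesselI (nu_of d) r).

Definition first_pos_zero (h : R -> R) (z : R) : Prop :=
  0 < z /\ h z = 0 /\ forall x, 0 < x < z -> h x <> 0.

(* b(a) = (1 - a^d)^(1/d), so that a^d + b(a)^d = 1, b(a) in [0,1] for a in [0,1] *)
Definition b_of (d : nat) (a : R) : R := rpow (1 - a ^ d) (/ INR d).

Definition K_of (d : nat) (a : R) : R := a ^ (d - 1) / (1 + (b_of d a) ^ (d - 1)).

Definition K'_of (d : nat) (a : R) : R := Derive (K_of d) a.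

Definition T1 (d : nat) (a : R) : R :=
  (a * K_of d a) ^ d * K'_of d a / K_of d a.
Definition G1 (d : nat) (k a : R) : R :=
  (a * K'_of d a + K_of d a) * (k * K_of d a) ^ (d - 1) * g_nu d (k * a * K_of d a).
Definition G2 (d : nat) (k a : R) : R := k ^ (d - 1) * g_nu d (k * b_of d a).

Definition F_nu (d : nat) (k a : R) : R :=
  f_nu d (k * K_of d a * a) + (K_of d a) ^ d * f_nu d (k * b_of d a).

(* Main.v *)
Require Import Defs.
From Stdlib Require Import Reals Lra Lia.
From Coquelicot Require Import Coquelicot.
Open Scope R_scope.

(** Write p = J_{nu+1}/J_nu and q = I_{nu+1}/I_nu.  The Riccati equations for p and q give
    f' = r^(d-1) (2 + f g) with f g = p^2 - q^2 and q < 1, so f increases on (0,j) and on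
    (j,k], where f is respectively positive and nonpositive.  Hence F is controlled on each
    cell of the partitions by the two endpoint values in the hypotheses, except on the
    cells touching 0 and 1, where F vanishes.  On the cell at 0, f(r) >= (2/d) r^d and
    (F/K^d)' <= (p - q)(k K a) (k K a)' F/K^d + C (G1 + G2) with C >= 0; since p - q is the
    logarithmic derivative of 1/(J_nu I_nu), up to powers of r, the integrating factor is
    explicit, and G1 + G2 is bounded by the assumed quantity because p - q increases on
    (0,j) and g on (j,k].  On the cell at 1, F' >= 0 as soon as 2 a K'/K >= (f g)(k b),
    which propagates to the right.

    The cells are placed correctly only if a_I < a_S, that is 2 (j/k)^d + j/k > 1.  This
    follows from r W' = W^2 + d W + r^2 for W = - r/p on [j,k], with W(j) = 0, together
    with j >= d/2 and j^2 >= 2 d. *)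

(** * Monotonicity and the Gamma integral *)

(** The obstacle is that [p] has a pole at [j] and that F/K^d is 0/0 at a = 0, so the quotients
    alone do not suffice. With (r/2)^nu factored out, J_nu and I_nu become one entire function
    evaluated at -r^2/4 and r^2/4; a sign [s] treats both at once. Write A, B, C for the functions
    of order nu, nu+1, nu+2, with subscript - or + for the sign. What must pass through [j] or reach
    0 is phrased with S = B_- A_+ + B_+ A_- and U = A_- A_+, where p + q = r S / (2 U) and S is
    smooth where p is not.

    The monotonicity of p - q and p^2 - q^2 on (0,j) has a single source: B^2 - A C >= 0 for both
    signs, which makes p/r increase and q/r decrease.

    The inequality 2 (j/k)^d + j/k > 1 is exactly a_I K(a_I) < j/k, because a K(a) = (1 - b^d) / (1
    + b^(d-1)). The bound j/k > exp(-2/d) drawn from j >= d/2 gives it for d >= 7 but is too weak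
    for d = 4, 5, 6; there j^2 >= 2 d is the better bound, used with explicit constants. *)

Lemma nondecreasing_of_derive (f df : R -> R) (a b : R) :
  a <= b ->
  (forall x, a <= x <= b -> continuous f x) ->
  (forall x, a < x < b -> is_derive f x (df x)) ->
  (forall x, a < x < b -> 0 <= df x) ->
  f a <= f b.
Proof.
  intros Hab Hc Hd Hp.
  (* [MVT_gen] returns a point of the closed interval, while the sign of [df] is known only inside;
     [df'] is patched so that the sign holds everywhere. *)
  pose (df' := fun x => if Rlt_dec a x then if Rlt_dec x b then df x else 0 else 0).
  assert (Hp' : forall x, 0 <= df' x).
  { intros x; unfold df'; destruct (Rlt_dec a x); destruct (Rlt_dec x b);
      try apply Hp; lra. }
  destruct (MVT_gen f a b df') as [c [_ Hc']].
  - rewrite Rmin_left, Rmax_right by lra. intros x Hx. unfold df'.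
    destruct (Rlt_dec a x); destruct (Rlt_dec x b); try lra. now apply Hd.
  - rewrite Rmin_left, Rmax_right by lra. intros x Hx.
    apply continuity_pt_filterlim. now apply Hc.
  - generalize (Hp' c); nra.
Qed.

Lemma increasing_of_derive (f df : R -> R) (a b : R) :
  a < b ->
  (forall x, a <= x <= b -> continuous f x) ->
  (forall x, a < x < b -> is_derive f x (df x)) ->
  (forall x, a < x < b -> 0 < df x) ->
  f a < f b.
Proof.
  intros Hab Hc Hd Hp.
  pose (df' := fun x => if Rlt_dec a x then if Rlt_dec x b then df x else 1 else 1).
  assert (Hp' : forall x, 0 < df' x).
  { intros x; unfold df'; destruct (Rlt_dec a x); destruct (Rlt_dec x b);
      try apply Hp; lra. }
  destruct (MVT_gen f a b df') as [c [_ Hc']].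
  - rewrite Rmin_left, Rmax_right by lra. intros x Hx. unfold df'.
    destruct (Rlt_dec a x); destruct (Rlt_dec x b); try lra. now apply Hd.
  - rewrite Rmin_left, Rmax_right by lra. intros x Hx.
    apply continuity_pt_filterlim. now apply Hc.
  - generalize (Hp' c); nra.
Qed.

Lemma continuous_of_derive (f : R -> R) (x l : R) : is_derive f x l -> continuous f x.
Proof.
  intros H. apply (ex_derive_continuous f x). now exists l.
Qed.

Lemma rpow_pos (x y : R) : 0 < x -> rpow x y = Rpower x y.
Proof. intros H; unfold rpow; destruct (Rlt_dec 0 x); [reflexivity | contradiction]. Qed.

Lemma rpow_nonpos (x y : R) : x <= 0 -> rpow x y = 0.
Proof. intros H; unfold rpow; destruct (Rlt_dec 0 x); lra. Qed.

Lemma rpow_ge0 (x y : R) : 0 <= rpow x y.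
Proof.
  destruct (Rlt_dec 0 x) as [H|H].
  - rewrite rpow_pos by easy. left; apply exp_pos.
  - rewrite rpow_nonpos; lra.
Qed.

Lemma is_derive_rpow (x y : R) :
  0 < x -> is_derive (fun t => rpow t y) x (y * rpow x (y - 1)).
Proof.
  intros Hx.
  apply is_derive_ext_loc with (fun t => exp (y * ln t)).
  - exists (mkposreal x Hx). intros t Ht. unfold ball in Ht; simpl in Ht.
    unfold AbsRing_ball, abs, minus, plus, opp in Ht; simpl in Ht.
    rewrite rpow_pos; [reflexivity|]. apply Rabs_def2 in Ht. lra.
  - rewrite rpow_pos by easy. auto_derive; [easy|].
    unfold Rpower. replace ((y - 1) * ln x) with (y * ln x - ln x) by ring.
    unfold Rminus. rewrite exp_plus, exp_Ropp, exp_ln by easy. field; lra.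
Qed.

Lemma continuous_rpow (x y : R) : 0 < y -> continuous (fun t => rpow t y) x.
Proof.
  intros Hy. destruct (total_order_T x 0) as [[Hx|Hx]|Hx].
  - apply (continuous_ext_loc _ (fun _ => 0)); [|apply continuous_const].
    exists (mkposreal (-x) ltac:(lra)). intros t Ht. unfold ball in Ht; simpl in Ht.
    unfold AbsRing_ball, abs, minus, plus, opp in Ht; simpl in Ht.
    rewrite rpow_nonpos; [reflexivity|]. apply Rabs_def2 in Ht. lra.
  - subst x. apply filterlim_locally. intros eps.
    (* The radius is eps^(1/y). *)
    exists (mkposreal _ (exp_pos (/ y * ln eps))). intros t Ht.
    change (Rabs (t - 0) < exp (/ y * ln eps)) in Ht.
    change (Rabs (rpow t y - rpow 0 y) < eps).
    rewrite (rpow_nonpos 0), Rminus_0_r by lra.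
    rewrite Rabs_pos_eq by apply rpow_ge0.
    destruct (Rlt_dec 0 t) as [H|H].
    + rewrite rpow_pos by easy. unfold Rpower.
      apply Rabs_def2 in Ht. destruct Ht as [Ht _].
      rewrite Rminus_0_r in Ht.
      apply ln_increasing in Ht; [|easy]. rewrite ln_exp in Ht.
      rewrite <- (exp_ln eps) by apply cond_pos.
      apply exp_increasing.
      apply Rmult_lt_compat_l with (r := y) in Ht; [|easy].
      replace (y * (/ y * ln eps)) with (ln eps) in Ht by (field; lra). exact Ht.
    + rewrite rpow_nonpos by lra. apply cond_pos.
  - eapply continuous_of_derive. now apply is_derive_rpow.
Qed.

Definition gamma_integrand (x t : R) : R := rpow t (x - 1) * exp (- t).

(** A proper integral when x > 1: the integrand is then continuous on the whole line, 0 included.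
    The Bessel coefficients call [Gamma] only at such arguments. *)
Definition gamma_partial (x b : R) : R := RInt (gamma_integrand x) 0 b.

Lemma continuous_gamma_integrand (x t : R) : 1 < x -> continuous (gamma_integrand x) t.
Proof.
  intros Hx. apply (continuous_mult (fun t => rpow t (x - 1)) (fun t => exp (- t))).
  - apply continuous_rpow; lra.
  - apply continuous_of_derive with (- exp (- t)). auto_derive; [easy|ring].
Qed.

Lemma is_RInt_gamma_integrand (x a b : R) :
  1 < x -> is_RInt (gamma_integrand x) a b (gamma_partial x b - gamma_partial x a).
Proof.
  intros Hx.
  assert (E : forall u v, ex_RInt (gamma_integrand x) u v).
  { intros u v. apply (ex_RInt_continuous (gamma_integrand x) u v). intros z _.
    now apply continuous_gamma_integrand. }
  unfold gamma_partial.
  replace (RInt (gamma_integrand x) 0 b - RInt (gamma_integrand x) 0 a)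
    with (RInt (gamma_integrand x) a b).
  - apply (RInt_correct (gamma_integrand x) a b). apply E.
  - pose proof (RInt_Chasles (gamma_integrand x) 0 a b (E _ _) (E _ _)) as H.
    change (RInt (gamma_integrand x) 0 a + RInt (gamma_integrand x) a b
            = RInt (gamma_integrand x) 0 b :> R) in H.
    rewrite <- H. apply eq_sym, (Rplus_minus_l (RInt (gamma_integrand x) 0 a)).
Qed.

Lemma gamma_partial_0 (x : R) : gamma_partial x 0 = 0.
Proof. unfold gamma_partial. apply (RInt_point 0 (gamma_integrand x)). Qed.

Lemma is_derive_gamma_partial (x b : R) :
  1 < x -> is_derive (gamma_partial x) b (gamma_integrand x b).
Proof.
  intros Hx. apply (is_derive_RInt _ _ 0).
  - apply filter_forall. intros c. generalize (is_RInt_gamma_integrand x 0 c Hx).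
    now rewrite gamma_partial_0, Rminus_0_r.
  - now apply continuous_gamma_integrand.
Qed.

(** Apply ln u <= u to u = t / (2 (x - 1)): the power of t costs only half of the exponential, and C
    = (2 (x - 1))^(x - 1). *)
Lemma gamma_integrand_bound (x : R) :
  1 < x -> exists C, 0 < C /\ forall t, gamma_integrand x t <= C * exp (- t / 2).
Proof.
  intros Hx. exists (exp ((x - 1) * ln (2 * (x - 1)))).
  split; [apply exp_pos|]. intros t. unfold gamma_integrand.
  destruct (Rlt_dec 0 t) as [Ht|Ht].
  - rewrite rpow_pos by easy. unfold Rpower. rewrite <- !exp_plus.
    assert (H : ln (t / (2 * (x - 1))) <= t / (2 * (x - 1))).
    { assert (Hp : 0 < t / (2 * (x - 1))) by (apply Rdiv_lt_0_compat; lra).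
      generalize (exp_ineq1_le (ln (t / (2 * (x - 1))))). rewrite exp_ln by easy. lra. }
    rewrite ln_div in H by lra.
    apply Rmult_le_compat_l with (r := x - 1) in H; [|lra].
    replace ((x - 1) * (t / (2 * (x - 1)))) with (t / 2) in H by (field; lra).
    destruct (Req_dec ((x - 1) * ln t + - t)
      ((x - 1) * ln (2 * (x - 1)) + - t / 2)) as [E|E].
    + rewrite E; lra.
    + left; apply exp_increasing. lra.
  - rewrite rpow_nonpos by lra.
    rewrite Rmult_0_l. apply Rmult_le_pos; left; apply exp_pos.
Qed.

Lemma gamma_integrand_ge0 (x t : R) : 0 <= gamma_integrand x t.
Proof. apply Rmult_le_pos; [apply rpow_ge0 | left; apply exp_pos]. Qed.

Lemma gamma_partial_monotone (x a b : R) :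
  1 < x -> a <= b -> gamma_partial x a <= gamma_partial x b.
Proof.
  intros Hx Hab. apply nondecreasing_of_derive with (gamma_integrand x); trivial.
  - intros y _. eapply continuous_of_derive. now apply is_derive_gamma_partial.
  - intros y _. now apply is_derive_gamma_partial.
  - intros y _. apply gamma_integrand_ge0.
Qed.

Lemma is_lim_gamma_partial (x : R) :
  1 < x -> exists l, 0 < l /\ is_lim (gamma_partial x) p_infty l.
Proof.
  intros Hx. destruct (gamma_integrand_bound x Hx) as [C [HC Hb]].
  assert (Hub : forall b, 0 <= b -> gamma_partial x b <= 2 * C).
  { intros b Hb0.
    (* [2 * C] is the integral of the bound C exp(-t/2) over the half line; [h] compares the two
       primitives. *)
    pose (h := fun t => - (gamma_partial x t + 2 * C * exp (- t / 2))).
    assert (Hd : forall t, is_derive h t (C * exp (- t / 2) - gamma_integrand x t)).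
    { intros t. unfold h. auto_derive.
      - exists (gamma_integrand x t). now apply is_derive_gamma_partial.
      - rewrite (is_derive_unique (fun b : R => gamma_partial x b) _ _ (is_derive_gamma_partial x t Hx)).
        change (- t * / 2) with (- t / 2). field. }
    assert (h 0 <= h b).
    { apply nondecreasing_of_derive with (fun t => C * exp (- t / 2) - gamma_integrand x t);
        [exact Hb0 | | |].
      - intros t _. eapply continuous_of_derive. apply Hd.
      - intros t _. apply Hd.
      - intros t _. generalize (Hb t). lra. }
    unfold h in H. rewrite gamma_partial_0 in H.
    replace (- 0 / 2) with 0 in H by field. rewrite exp_0 in H.
    generalize (exp_pos (- b / 2)); nra. }
  pose (E := fun y => exists b, 0 <= b /\ y = gamma_partial x b).
  destruct (completeness E) as [l [Hl1 Hl2]].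
  - exists (2 * C). intros y [b [Hb0 ->]]. now apply Hub.
  - exists (gamma_partial x 0), 0. split; [lra|easy].
  - exists l. split.
    + apply Rlt_le_trans with (gamma_partial x 1).
      * rewrite <- (gamma_partial_0 x).
        apply increasing_of_derive with (gamma_integrand x); [lra| | |].
        -- intros y _. eapply continuous_of_derive. now apply is_derive_gamma_partial.
        -- intros y _. now apply is_derive_gamma_partial.
        -- intros y Hy. unfold gamma_integrand. rewrite rpow_pos by lra.
           apply Rmult_lt_0_compat; apply exp_pos.
      * apply Hl1. exists 1. split; [lra|easy].
    + apply is_lim_spec. intros eps.
      destruct (Classical_Prop.classic (exists b, 0 <= b /\ l - eps < gamma_partial x b))
        as [[b [Hb0 Hb1]]|Hn].
      * exists b. intros y Hy.
        assert (gamma_partial x b <= gamma_partial x y)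
          by (apply gamma_partial_monotone; lra).
        assert (gamma_partial x y <= l) by (apply Hl1; exists y; split; [lra|easy]).
        apply Rabs_def1; generalize (cond_pos eps); lra.
      * exfalso. assert (l <= l - eps).
        { apply Hl2. intros y [b [Hb0 ->]]. apply Rnot_lt_le. intros H.
          apply Hn. exists b. tauto. }
        generalize (cond_pos eps); lra.
Qed.

Lemma is_lim_gamma_partial_Gamma (x : R) :
  1 < x -> 0 < Gamma x /\ is_lim (gamma_partial x) p_infty (Gamma x).
Proof.
  intros Hx. destruct (is_lim_gamma_partial x Hx) as [l [Hl0 Hl]].
  replace (Gamma x) with l; [easy|]. symmetry.
  unfold Gamma. apply is_RInt_gen_unique.
  intros P [eps HP].
  (* [Gamma] is improper at both ends, so eps is shared: one half for the lower limit, by continuity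
     of [gamma_partial] at 0, one half for the upper limit. *)
  assert (H0 : at_right 0 (fun a => Rabs (gamma_partial x a) < eps / 2)).
  { assert (Hc : continuous (gamma_partial x) 0).
    { eapply continuous_of_derive. now apply is_derive_gamma_partial. }
    assert (He : 0 < eps / 2) by (generalize (cond_pos eps); lra).
    apply (proj1 (filterlim_locally _ _)) with (eps := mkposreal _ He) in Hc.
    apply filter_le_within. revert Hc. apply filter_imp. intros a Ha.
    change (Rabs (gamma_partial x a - gamma_partial x 0) < eps / 2) in Ha.
    now rewrite gamma_partial_0, Rminus_0_r in Ha. }
  assert (H1 : Rbar_locally p_infty (fun b => Rabs (gamma_partial x b - l) < eps / 2)).
  { apply is_lim_spec in Hl.
    assert (He : 0 < eps / 2) by (generalize (cond_pos eps); lra).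
    apply (Hl (mkposreal _ He)). }
  apply Filter_prod with (1 := H0) (2 := H1). intros a b Ha Hb.
  exists (gamma_partial x b - gamma_partial x a). split.
  - now apply is_RInt_gamma_integrand.
  - apply HP. unfold ball; simpl. unfold AbsRing_ball, abs, minus, plus, opp; simpl.
    apply Rabs_def2 in Ha. apply Rabs_def2 in Hb. apply Rabs_def1; lra.
Qed.

Lemma Gamma_pos (x : R) : 1 < x -> 0 < Gamma x.
Proof. intros Hx. now apply is_lim_gamma_partial_Gamma. Qed.

(** Integration by parts: the difference [h] of the two sides has zero derivative for t > 0 and is
    continuous at 0, where it vanishes. *)
Lemma gamma_partial_succ (x b : R) :
  1 < x -> 0 <= b ->
  gamma_partial (x + 1) b = x * gamma_partial x b - gamma_integrand (x + 1) b.
Proof.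
  intros Hx Hb.
  pose (h := fun t => x * gamma_partial x t - gamma_partial (x + 1) t
                      - rpow t x * exp (- t)).
  assert (Hd : forall t, 0 < t -> is_derive h t 0).
  { intros t Ht. unfold h.
    pose proof (is_derive_gamma_partial x t Hx) as D1.
    pose proof (is_derive_gamma_partial (x + 1) t ltac:(lra)) as D2.
    pose proof (is_derive_rpow t x Ht) as D3.
    auto_derive.
    - repeat split; eexists; eassumption.
    - rewrite (is_derive_unique (fun b : R => gamma_partial x b) _ _ D1),
        (is_derive_unique (fun b : R => gamma_partial (x + 1) b) _ _ D2),
        (is_derive_unique (fun t : R => rpow t x) _ _ D3).
      unfold gamma_integrand. replace (x + 1 - 1) with x by ring. ring. }
  assert (Hc : forall t, continuous h t).
  { intros t. unfold h.
    apply (continuous_minus (fun t => x * gamma_partial x t - gamma_partial (x + 1) t)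
             (fun t => rpow t x * exp (- t))).
    - apply (continuous_minus (fun t => x * gamma_partial x t) (gamma_partial (x + 1))).
      + apply (continuous_scal_r x (gamma_partial x)).
        eapply continuous_of_derive. now apply is_derive_gamma_partial.
      + eapply continuous_of_derive. apply is_derive_gamma_partial. lra.
    - apply (continuous_ext (gamma_integrand (x + 1))).
      + intros s. unfold gamma_integrand. now replace (x + 1 - 1) with x by ring.
      + apply continuous_gamma_integrand. lra. }
  assert (H1 : h 0 <= h b).
  { apply nondecreasing_of_derive with (fun _ => 0); [exact Hb | | |].
    - intros t _; apply Hc.
    - intros t Ht; now apply Hd.
    - intros; lra. }
  assert (H2 : - h 0 <= - h b).
  { apply (nondecreasing_of_derive (fun t => - h t) (fun _ => 0)); [exact Hb | | |].
    - intros t _. apply (continuous_opp h). apply Hc.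
    - intros t Ht. rewrite <- Ropp_0. apply (is_derive_opp h). now apply Hd.
    - intros; lra. }
  assert (E : h b = 0).
  { replace 0 with (h 0); [lra|]. unfold h.
    rewrite !gamma_partial_0, rpow_nonpos by lra. ring. }
  unfold h in E. unfold gamma_integrand. replace (x + 1 - 1) with x by ring. lra.
Qed.

Lemma Gamma_succ (x : R) : 1 < x -> Gamma (x + 1) = x * Gamma x.
Proof.
  intros Hx.
  destruct (is_lim_gamma_partial_Gamma x Hx) as [_ L1].
  destruct (is_lim_gamma_partial_Gamma (x + 1) ltac:(lra)) as [_ L2].
  destruct (gamma_integrand_bound (x + 1) ltac:(lra)) as [C [HC Hb]].
  assert (L3 : is_lim (gamma_integrand (x + 1)) p_infty 0).
  { apply (is_lim_le_le_loc (fun _ => 0) (fun t => C * exp (- t / 2))).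
    - exists 0. intros t _. split; [apply gamma_integrand_ge0 | apply Hb].
    - apply is_lim_const.
    - replace (Finite 0) with (Rbar_mult C 0) by (simpl; f_equal; ring).
      apply is_lim_scal_l.
      apply (is_lim_comp exp (fun t => - t / 2) p_infty 0 m_infty).
      + apply is_lim_exp_m.
      + apply (is_lim_ext (fun t => (- / 2) * t)); [intros; field|].
        apply is_lim_spec. intros M. exists (-2 * M). intros t Ht. lra.
      + now exists 0. }
  assert (L4 : is_lim (gamma_partial (x + 1)) p_infty (x * Gamma x - 0)).
  { apply is_lim_ext_loc with
      (fun b => x * gamma_partial x b - gamma_integrand (x + 1) b).
    - exists 0. intros b Hb0. rewrite gamma_partial_succ; lra.
    - apply is_lim_minus'; [|exact L3].
      apply (is_lim_scal_l (gamma_partial x) x p_infty (Gamma x)). exact L1. }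
  apply is_lim_unique in L2. apply is_lim_unique in L4.
  rewrite L2 in L4. injection L4. lra.
Qed.

(** * Bessel-Clifford functions *)

Definition clifford_coef (nu : R) (k : nat) : R :=
  / (INR (Factorial.fact k) * Gamma (INR k + nu + 1)).

(* The Bessel-Clifford function: J_nu(r) and I_nu(r) are (r/2)^nu times its value at
   -r^2/4 and r^2/4. *)
Definition clifford (nu z : R) : R := PSeries (clifford_coef nu) z.

Lemma clifford_coef_pos (nu : R) (k : nat) : 0 < nu -> 0 < clifford_coef nu k.
Proof.
  intros Hnu. apply Rinv_0_lt_compat, Rmult_lt_0_compat.
  - apply INR_fact_lt_0.
  - apply Gamma_pos. generalize (pos_INR k); lra.
Qed.

(** On the series this says that differentiation raises the order by one. *)
Lemma clifford_coef_succ_index (nu : R) (k : nat) :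
  0 < nu -> INR (S k) * clifford_coef nu (S k) = clifford_coef (nu + 1) k.
Proof.
  intros Hnu. unfold clifford_coef. rewrite fact_simpl, mult_INR.
  replace (INR (S k) + nu + 1) with (INR k + (nu + 1) + 1) by (rewrite S_INR; ring).
  assert (0 < Gamma (INR k + (nu + 1) + 1))
    by (apply Gamma_pos; generalize (pos_INR k); lra).
  generalize (INR_fact_neq_0 k) (not_0_INR (S k) ltac:(lia)); intros. field. lra.
Qed.

Lemma clifford_coef_succ_order (nu : R) (k : nat) :
  0 < nu -> clifford_coef nu k = (INR k + nu + 1) * clifford_coef (nu + 1) k.
Proof.
  intros Hnu. unfold clifford_coef.
  replace (INR k + (nu + 1) + 1) with (INR k + nu + 1 + 1) by ring.
  generalize (pos_INR k); intros Hk.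
  rewrite (Gamma_succ (INR k + nu + 1)) by lra.
  assert (0 < Gamma (INR k + nu + 1)) by (apply Gamma_pos; lra).
  generalize (INR_fact_neq_0 k); intros. field. lra.
Qed.

Lemma CV_radius_clifford (nu : R) : 0 < nu -> CV_radius (clifford_coef nu) = p_infty.
Proof.
  intros Hnu. apply CV_radius_infinite_DAlembert.
  - intros n. generalize (clifford_coef_pos nu n Hnu); lra.
  - apply is_lim_seq_le_le with (fun _ => 0) (fun n => / INR (S n)).
    + intros n.
      assert (E : clifford_coef nu (S n) / clifford_coef nu n
                  = / (INR (S n) * (INR n + nu + 1))).
      { rewrite (clifford_coef_succ_order nu n), <- clifford_coef_succ_index by easy.
        generalize (clifford_coef_pos nu (S n) Hnu) (pos_INR n)
          (lt_0_INR (S n) ltac:(lia)); intros. field. lra. }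
      rewrite E. generalize (pos_INR n) (lt_0_INR (S n) ltac:(lia)); intros.
      assert (0 < INR (S n) * (INR n + nu + 1)) by (apply Rmult_lt_0_compat; lra).
      rewrite Rabs_pos_eq.
      * split; [left; now apply Rinv_0_lt_compat|]. apply Rinv_le_contravar; nra.
      * left; now apply Rinv_0_lt_compat.
    + apply is_lim_seq_const.
    + apply (is_lim_seq_incr_1 (fun n => / INR n)).
      apply (is_lim_seq_inv INR p_infty); [apply is_lim_seq_INR | easy].
Qed.

Lemma ex_pseries_clifford (nu z : R) : 0 < nu -> ex_pseries (clifford_coef nu) z.
Proof. intros Hnu. apply CV_radius_inside. now rewrite CV_radius_clifford. Qed.

Lemma is_derive_clifford (nu z : R) :
  0 < nu -> is_derive (clifford nu) z (clifford (nu + 1) z).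
Proof.
  intros Hnu. unfold clifford.
  replace (PSeries (clifford_coef (nu + 1)) z)
    with (PSeries (PS_derive (clifford_coef nu)) z).
  - apply is_derive_PSeries. now rewrite CV_radius_clifford.
  - apply PSeries_ext. intros n. now apply clifford_coef_succ_index.
Qed.

(** The three-term recurrences of J_nu and I_nu in one. On coefficients the factor k + nu + 1
    splits: nu + 1 gives the first term, and k raises the order while lowering the index, which is
    the shift by z. *)
Lemma clifford_recurrence (nu z : R) :
  0 < nu ->
  clifford nu z = (nu + 1) * clifford (nu + 1) z + z * clifford (nu + 2) z.
Proof.
  intros Hnu. unfold clifford.
  rewrite <- PSeries_incr_1, <- PSeries_scal, <- PSeries_plus.
  - apply PSeries_ext. intros [|n].
    + change (clifford_coef nu 0 = (nu + 1) * clifford_coef (nu + 1) 0 + 0).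
      rewrite clifford_coef_succ_order by easy. rewrite INR_0. ring.
    + change (clifford_coef nu (S n)
              = (nu + 1) * clifford_coef (nu + 1) (S n) + clifford_coef (nu + 2) n).
      rewrite clifford_coef_succ_order by easy.
      replace (nu + 2) with (nu + 1 + 1) by ring.
      rewrite <- (clifford_coef_succ_index (nu + 1) n) by lra. ring.
  - apply ex_pseries_scal; [apply Rmult_comm|]. apply ex_pseries_clifford; lra.
  - apply ex_pseries_incr_1, ex_pseries_clifford; lra.
Qed.

Lemma clifford_ge0 (nu z : R) : 0 < nu -> 0 <= z -> 0 <= clifford nu z.
Proof.
  intros Hnu Hz. unfold clifford, PSeries.
  (* The zero series is written with a factor 0 so that [Series_scal_l] evaluates it without any
     convergence argument. *)
  replace 0 with (Series (fun _ => 0 * 0)).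
  - apply Series_le.
    + intros n. rewrite Rmult_0_l. split; [lra|].
      apply Rmult_le_pos; [left; now apply clifford_coef_pos | now apply pow_le].
    + apply ex_series_ext with (2 := ex_pseries_clifford nu z Hnu).
      intros n. rewrite pow_n_pow. apply Rmult_comm.
  - rewrite Series_scal_l. ring.
Qed.

Lemma clifford_pos (nu z : R) : 0 < nu -> 0 <= z -> 0 < clifford nu z.
Proof.
  intros Hnu Hz. apply Rlt_le_trans with (clifford nu 0).
  - unfold clifford. rewrite PSeries_0. now apply clifford_coef_pos.
  - apply nondecreasing_of_derive with (clifford (nu + 1)); [easy | | |].
    + intros x _. eapply continuous_of_derive. now apply is_derive_clifford.
    + intros x _. now apply is_derive_clifford.
    + intros x Hx. apply clifford_ge0; lra.
Qed.

Lemma rpow_even_shift (nu r : R) (k : nat) :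
  0 < r -> rpow (r / 2) (2 * INR k + nu) = (r ^ 2 / 4) ^ k * Rpower (r / 2) nu.
Proof.
  intros Hr. rewrite rpow_pos by lra. rewrite Rpower_plus. f_equal.
  replace (2 * INR k) with (INR (2 * k)) by (rewrite mult_INR; simpl; ring).
  rewrite Rpower_pow by lra. rewrite pow_mult. f_equal. field.
Qed.

Lemma BesselJ_clifford (nu r : R) :
  0 < r -> BesselJ nu r = clifford nu (- (r ^ 2 / 4)) * Rpower (r / 2) nu.
Proof.
  intros Hr. unfold BesselJ, clifford, PSeries. rewrite <- Series_scal_r.
  apply Series_ext. intros k. rewrite rpow_even_shift by easy.
  unfold clifford_coef, Rdiv at 1.
  replace (- (r ^ 2 / 4)) with (-1 * (r ^ 2 / 4)) by ring.
  rewrite (Rpow_mult_distr (-1)). ring.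
Qed.

Lemma BesselI_clifford (nu r : R) :
  0 < r -> BesselI nu r = clifford nu (r ^ 2 / 4) * Rpower (r / 2) nu.
Proof.
  intros Hr. unfold BesselI, clifford, PSeries. rewrite <- Series_scal_r.
  apply Series_ext. intros k. rewrite rpow_even_shift by easy.
  unfold clifford_coef. ring.
Qed.

(** * The Bessel ratios as functions of the radius *)

Lemma is_derive_Rplus (f g : R -> R) (x a b : R) :
  is_derive f x a -> is_derive g x b -> is_derive (fun t => f t + g t) x (a + b).
Proof. exact (is_derive_plus f g x a b). Qed.

Lemma is_derive_Rminus (f g : R -> R) (x a b : R) :
  is_derive f x a -> is_derive g x b -> is_derive (fun t => f t - g t) x (a - b).
Proof. exact (is_derive_minus f g x a b). Qed.

Lemma is_derive_Ropp (f : R -> R) (x a : R) :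
  is_derive f x a -> is_derive (fun t => - f t) x (- a).
Proof. exact (is_derive_opp f x a). Qed.

Lemma is_derive_Rmult (f g : R -> R) (x a b : R) :
  is_derive f x a -> is_derive g x b ->
  is_derive (fun t => f t * g t) x (a * g x + f x * b).
Proof. intros Hf Hg. exact (is_derive_mult f g x a b Hf Hg Rmult_comm). Qed.

Lemma is_derive_Rinv (f : R -> R) (x a : R) :
  f x <> 0 -> is_derive f x a -> is_derive (fun t => / f t) x (- a / f x ^ 2).
Proof. intros H Hf. exact (is_derive_inv f x a Hf H). Qed.

Lemma is_derive_Rdiv (f g : R -> R) (x a b : R) :
  g x <> 0 -> is_derive f x a -> is_derive g x b ->
  is_derive (fun t => f t / g t) x ((a * g x - f x * b) / g x ^ 2).
Proof.
  intros H Hf Hg. exact (is_derive_div f g x a b Hf Hg H).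
Qed.

Lemma is_derive_Rcst (c x : R) : is_derive (fun _ : R => c) x 0.
Proof. exact (is_derive_const c x). Qed.

Lemma is_derive_Rid (x : R) : is_derive (fun t : R => t) x 1.
Proof. exact (is_derive_id x). Qed.

Lemma is_derive_Rpow (f : R -> R) (n : nat) (x a : R) :
  f x <> 0 -> is_derive f x a ->
  is_derive (fun t => f t ^ n) x (INR n * f x ^ n / f x * a).
Proof.
  intros H Hf. replace (INR n * f x ^ n / f x * a) with (INR n * a * f x ^ pred n).
  - exact (is_derive_pow f n x a Hf).
  - destruct n as [|n]; [simpl; field; easy|]. simpl pred. simpl pow. field. easy.
Qed.

Lemma is_derive_Rcomp (f g : R -> R) (x a b : R) :
  is_derive f (g x) a -> is_derive g x b -> is_derive (fun t => f (g t)) x (a * b).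
Proof.
  intros Hf Hg. rewrite Rmult_comm. exact (is_derive_comp f g x a b Hf Hg).
Qed.

Lemma is_derive_value (f : R -> R) (x a b : R) : is_derive f x a -> a = b -> is_derive f x b.
Proof. now intros H <-. Qed.

(* Value at s r^2/4 of the Bessel-Clifford function of order nu and of its first two
   derivatives, where s = -1 gives J and s = 1 gives I. *)
Definition bA (d : nat) (s r : R) : R := clifford (nu_of d) (s * (r ^ 2 / 4)).
Definition bB (d : nat) (s r : R) : R := clifford (nu_of d + 1) (s * (r ^ 2 / 4)).
Definition bC (d : nat) (s r : R) : R := clifford (nu_of d + 2) (s * (r ^ 2 / 4)).

Lemma INR_ge4 (d : nat) : (4 <= d)%nat -> 4 <= INR d.
Proof. intros H. apply le_INR in H. now rewrite (INR_IZR_INZ 4) in H. Qed.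

Lemma INR_pred (d : nat) : (4 <= d)%nat -> INR (d - 1) = INR d - 1.
Proof. intros H. rewrite minus_INR by lia. reflexivity. Qed.

Lemma nu_of_pos (d : nat) : (4 <= d)%nat -> 0 < nu_of d.
Proof. intros H. apply INR_ge4 in H. unfold nu_of. lra. Qed.

Lemma is_derive_clifford_quadratic (nu s r : R) :
  0 < nu ->
  is_derive (fun t => clifford nu (s * (t ^ 2 / 4))) r
    (s * (r / 2) * clifford (nu + 1) (s * (r ^ 2 / 4))).
Proof.
  intros Hnu. eapply is_derive_value.
  - apply (is_derive_Rcomp (clifford nu) (fun t => s * (t ^ 2 / 4))).
    + now apply is_derive_clifford.
    + auto_derive; [easy|reflexivity].
  - field.
Qed.

Lemma is_derive_bA (d : nat) (s r : R) :
  (4 <= d)%nat -> is_derive (bA d s) r (s * (r / 2) * bB d s r).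
Proof. intros Hd. apply is_derive_clifford_quadratic. now apply nu_of_pos. Qed.

Lemma is_derive_bB_bC (d : nat) (s r : R) :
  (4 <= d)%nat -> is_derive (bB d s) r (s * (r / 2) * bC d s r).
Proof.
  intros Hd. unfold bC. replace (nu_of d + 2) with (nu_of d + 1 + 1) by ring.
  apply is_derive_clifford_quadratic. apply nu_of_pos in Hd. lra.
Qed.

Lemma bA_recurrence (d : nat) (s r : R) :
  (4 <= d)%nat -> bA d s r = INR d / 2 * bB d s r + s * (r ^ 2 / 4) * bC d s r.
Proof.
  intros Hd. unfold bA at 1. rewrite clifford_recurrence by now apply nu_of_pos.
  fold (bB d s r). fold (bC d s r). unfold nu_of. field.
Qed.

(** The recurrence eliminates [bC], so [bA] and [bB] form a closed linear system. The price is a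
    division by r; [is_derive_bB_bC] remains the form that is valid at 0. *)
Lemma is_derive_bB (d : nat) (s r : R) :
  (4 <= d)%nat -> r <> 0 ->
  is_derive (bB d s) r ((2 * bA d s r - INR d * bB d s r) / r).
Proof.
  intros Hd Hr. eapply is_derive_value; [now apply is_derive_bB_bC|].
  rewrite bA_recurrence by easy. field. easy.
Qed.

Lemma continuous_bA (d : nat) (s r : R) : (4 <= d)%nat -> continuous (bA d s) r.
Proof. intros Hd. eapply continuous_of_derive. now apply is_derive_bA. Qed.

Lemma continuous_bB (d : nat) (s r : R) : (4 <= d)%nat -> continuous (bB d s) r.
Proof. intros Hd. eapply continuous_of_derive. now apply is_derive_bB_bC. Qed.

Lemma bA_0 (d : nat) (s : R) : bA d s 0 = clifford (nu_of d) 0.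
Proof. unfold bA. f_equal. field. Qed.

Lemma bB_0 (d : nat) (s : R) : bB d s 0 = clifford (nu_of d + 1) 0.
Proof. unfold bB. f_equal. field. Qed.

Lemma bA_0_pos (d : nat) (s : R) : (4 <= d)%nat -> 0 < bA d s 0.
Proof. intros Hd. rewrite bA_0. apply clifford_pos; [now apply nu_of_pos | lra]. Qed.

Lemma bA_plus_pos (d : nat) (r : R) : (4 <= d)%nat -> 0 < bA d 1 r.
Proof. intros Hd. apply clifford_pos; [now apply nu_of_pos | nra]. Qed.

Lemma bB_plus_pos (d : nat) (r : R) : (4 <= d)%nat -> 0 < bB d 1 r.
Proof. intros Hd. apply clifford_pos; [apply nu_of_pos in Hd; lra | nra]. Qed.

(** For r > 0 and up to the factor (r/2)^(2 nu + 2), this is J_{nu+1}^2 - J_nu J_{nu+2} at s = -1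
    and the same expression in I at s = 1. *)
Definition turan (d : nat) (s r : R) : R := bB d s r ^ 2 - bA d s r * bC d s r.

(** The weight r^(d+2) is the one for which the recurrences of orders nu and nu+1 reduce the
    derivative to the square term 2 r^(d+1) B^2, whatever s is. Started at 0 it gives the sign of
    [turan]; started at [j] it gives strict positivity beyond [j]. *)
Lemma turan_scaled_monotone (d : nat) (s x y : R) :
  (4 <= d)%nat -> 0 <= x <= y ->
  x ^ (d + 2) * turan d s x <= y ^ (d + 2) * turan d s y.
Proof.
  intros Hd [Hx Hxy].
  pose (bD := fun r => clifford (nu_of d + 2 + 1) (s * (r ^ 2 / 4))).
  pose proof (nu_of_pos d Hd) as Hnu.
  assert (HC : forall r, is_derive (bC d s) r (s * (r / 2) * bD r)).
  { intros r. apply is_derive_clifford_quadratic. lra. }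
  assert (Hrec : forall r, bB d s r = (INR d / 2 + 1) * bC d s r + s * (r ^ 2 / 4) * bD r).
  { intros r. unfold bB at 1. rewrite clifford_recurrence by lra.
    unfold bC, bD. replace (nu_of d + 1 + 1) with (nu_of d + 2) by ring.
    replace (nu_of d + 1 + 2) with (nu_of d + 2 + 1) by ring. unfold nu_of. field. }
  assert (Hder : forall r, 0 < r ->
    is_derive (fun r => r ^ (d + 2) * turan d s r) r (r ^ (d + 2) / r * (2 * bB d s r ^ 2))).
  { intros r Hr. unfold turan.
    pose proof (is_derive_bA d s r Hd) as DA.
    pose proof (is_derive_bB_bC d s r Hd) as DB.
    pose proof (HC r) as DC.
    eapply is_derive_value.
    - apply (is_derive_Rmult (fun r => r ^ (d + 2))).
      + apply (is_derive_Rpow (fun r => r)); [lra|apply is_derive_Rid].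
      + apply (is_derive_Rminus (fun r => bB d s r ^ 2) (fun r => bA d s r * bC d s r)).
        * apply (is_derive_ext (fun r => bB d s r * bB d s r)); [intros; simpl; ring|].
          apply (is_derive_Rmult (bB d s) (bB d s)); exact DB.
        * apply (is_derive_Rmult (bA d s) (bC d s)); [exact DA | exact DC].
    - pose proof (bA_recurrence d s r Hd) as RA. pose proof (Hrec r) as RB.
      rewrite plus_INR. simpl (INR 2).
      assert (K : s * r * (bC d s r * bB d s r) * r - s * r * bA d s r * bD r * r
        = - INR d * bB d s r ^ 2 * 2 + 2 * (INR d + 2) * bA d s r * bC d s r).
      { assert (RA' : s * r ^ 2 * bC d s r = 4 * bA d s r - 2 * INR d * bB d s r) by lra.
        assert (RB' : s * r ^ 2 * bD r = 4 * bB d s r - (2 * INR d + 4) * bC d s r) by lra.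
        replace (s * r * (bC d s r * bB d s r) * r)
          with (s * r ^ 2 * bC d s r * bB d s r) by ring.
        replace (s * r * bA d s r * bD r * r)
          with (s * r ^ 2 * bD r * bA d s r) by ring.
        rewrite RA', RB'. ring. }
      apply Rmult_eq_reg_r with (2 * r); [|lra].
      transitivity (r ^ (d + 2) * ((INR d + (1 + 1)) * 2 * (bB d s r ^ 2 - bA d s r * bC d s r)
        + (s * r * (bC d s r * bB d s r) * r - s * r * bA d s r * bD r * r))).
      { field. lra. }
      rewrite K. field. lra. }
  apply (nondecreasing_of_derive (fun r => r ^ (d + 2) * turan d s r)
           (fun r => r ^ (d + 2) / r * (2 * bB d s r ^ 2))); [easy | | |].
  - intros r _. apply (continuous_mult (fun r => r ^ (d + 2)) (turan d s)).
    + apply (ex_derive_continuous (fun r : R => r ^ (d + 2))). auto_derive; easy.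
    + apply (continuous_minus (fun r => bB d s r ^ 2) (fun r => bA d s r * bC d s r)).
      * apply (continuous_ext (fun r => bB d s r * bB d s r)); [intros; simpl; ring|].
        apply (continuous_mult (bB d s) (bB d s)); now apply continuous_bB.
      * apply (continuous_mult (bA d s) (bC d s)); [now apply continuous_bA|].
        eapply continuous_of_derive, HC.
  - intros r Hr. apply Hder. lra.
  - intros r Hr. apply Rmult_le_pos; [|nra].
    left. apply Rdiv_lt_0_compat; [apply pow_lt|]; lra.
Qed.

Lemma turan_ge0 (d : nat) (s r : R) : (4 <= d)%nat -> 0 < r -> 0 <= turan d s r.
Proof.
  intros Hd Hr. pose proof (turan_scaled_monotone d s 0 r Hd ltac:(lra)) as H.
  rewrite pow_i in H by lia. pose proof (pow_lt r (d + 2) Hr). nra.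
Qed.

(** This is 2 p / r for s = -1 and 2 q / r for s = 1; the division by r makes it regular at 0 and
    its derivative a multiple of [turan]. *)
Definition bW (d : nat) (s r : R) : R := bB d s r / bA d s r.

Lemma is_derive_bW (d : nat) (s r : R) :
  (4 <= d)%nat -> bA d s r <> 0 ->
  is_derive (bW d s) r (- s * (r / 2) * turan d s r / bA d s r ^ 2).
Proof.
  intros Hd HA. eapply is_derive_value.
  - apply (is_derive_Rdiv (bB d s) (bA d s)); [easy | now apply is_derive_bB_bC |
      now apply is_derive_bA].
  - unfold turan. field. easy.
Qed.

Lemma continuous_bW (d : nat) (s r : R) :
  (4 <= d)%nat -> bA d s r <> 0 -> continuous (bW d s) r.
Proof. intros Hd HA. eapply continuous_of_derive. now apply is_derive_bW. Qed.

Lemma bW_plus_decreasing (d : nat) (x y : R) :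
  (4 <= d)%nat -> 0 <= x <= y -> bW d 1 y <= bW d 1 x.
Proof.
  intros Hd [Hx Hy]. apply Ropp_le_cancel.
  assert (HA : forall r, bA d 1 r <> 0)
    by (intros r; generalize (bA_plus_pos d r Hd); lra).
  apply (nondecreasing_of_derive (fun r => - bW d 1 r)
    (fun r => - (- 1 * (r / 2) * turan d 1 r / bA d 1 r ^ 2))); [easy | | |].
  - intros r _. apply (continuous_opp (bW d 1)). now apply continuous_bW.
  - intros r _. apply is_derive_Ropp. now apply is_derive_bW.
  - intros r Hr. assert (0 < r) by lra. pose proof (turan_ge0 d 1 r Hd H).
    replace (- (- 1 * (r / 2) * turan d 1 r / bA d 1 r ^ 2))
      with (r / 2 * turan d 1 r / bA d 1 r ^ 2) by (field; easy).
    apply Rmult_le_pos; [nra|]. left; apply Rinv_0_lt_compat, pow_lt, bA_plus_pos, Hd.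
Qed.

Lemma bW_minus_increasing (d : nat) (x y : R) :
  (4 <= d)%nat -> 0 <= x <= y -> (forall r, x <= r <= y -> bA d (-1) r <> 0) ->
  bW d (-1) x <= bW d (-1) y.
Proof.
  intros Hd [Hx Hy] HA.
  apply (nondecreasing_of_derive (bW d (-1))
    (fun r => - -1 * (r / 2) * turan d (-1) r / bA d (-1) r ^ 2)); [easy | | |].
  - intros r Hr. apply continuous_bW; auto.
  - intros r Hr. apply is_derive_bW; auto. apply HA; lra.
  - intros r Hr. assert (0 < r) by lra. pose proof (turan_ge0 d (-1) r Hd H).
    assert (bA d (-1) r <> 0) by (apply HA; lra).
    apply Rmult_le_pos; [nra|]. left; apply Rinv_0_lt_compat. now apply pow2_gt_0.
Qed.

Definition bP (d : nat) (r : R) : R := r / 2 * bW d (-1) r.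
Definition bQ (d : nat) (r : R) : R := r / 2 * bW d 1 r.

Lemma is_derive_riccati (d : nat) (s r : R) :
  (4 <= d)%nat -> 0 < r -> bA d s r <> 0 ->
  is_derive (fun r => r / 2 * bW d s r) r
    (1 - s * (r / 2 * bW d s r) ^ 2 - (INR d - 1) / r * (r / 2 * bW d s r)).
Proof.
  intros Hd Hr HA. eapply is_derive_value.
  - apply (is_derive_Rmult (fun r => r / 2) (bW d s)).
    + apply (is_derive_Rdiv (fun r => r) (fun _ => 2)); [lra | apply is_derive_Rid |
        apply is_derive_Rcst].
    + apply (is_derive_Rdiv (bB d s) (bA d s)); [easy | apply is_derive_bB; [easy | lra] |
        now apply is_derive_bA].
  - unfold bW. field. lra.
Qed.

Lemma is_derive_bP (d : nat) (r : R) :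
  (4 <= d)%nat -> 0 < r -> bA d (-1) r <> 0 ->
  is_derive (bP d) r (1 + bP d r ^ 2 - (INR d - 1) / r * bP d r).
Proof.
  intros Hd Hr HA. eapply is_derive_value; [now apply is_derive_riccati|].
  unfold bP. ring.
Qed.

Lemma is_derive_bQ (d : nat) (r : R) :
  (4 <= d)%nat -> 0 < r ->
  is_derive (bQ d) r (1 - bQ d r ^ 2 - (INR d - 1) / r * bQ d r).
Proof.
  intros Hd Hr. eapply is_derive_value.
  - apply is_derive_riccati; [easy | easy |].
    generalize (bA_plus_pos d r Hd); lra.
  - unfold bQ. ring.
Qed.

Lemma bQ_pos (d : nat) (r : R) : (4 <= d)%nat -> 0 < r -> 0 < bQ d r.
Proof.
  intros Hd Hr. unfold bQ, bW. apply Rmult_lt_0_compat; [lra|].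
  apply Rdiv_lt_0_compat; [now apply bB_plus_pos | now apply bA_plus_pos].
Qed.

(* With v = A(r^2/4), the energy v^2 - v'^2 is nondecreasing, and q = v'/v. *)
Lemma bQ_lt1 (d : nat) (r : R) : (4 <= d)%nat -> 0 < r -> bQ d r < 1.
Proof.
  intros Hd Hr.
  assert (H : bA d 1 0 ^ 2 - (0 / 2 * bB d 1 0) ^ 2
              <= bA d 1 r ^ 2 - (r / 2 * bB d 1 r) ^ 2).
  { apply (nondecreasing_of_derive (fun r => bA d 1 r ^ 2 - (r / 2 * bB d 1 r) ^ 2)
      (fun r => (INR d - 1) * (r / 2) * bB d 1 r ^ 2)); [lra | | |].
    - intros x _.
      apply (continuous_minus (fun r => bA d 1 r ^ 2) (fun r => (r / 2 * bB d 1 r) ^ 2)).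
      + apply (continuous_comp (bA d 1) (fun y => y ^ 2)); [now apply continuous_bA|].
        apply (ex_derive_continuous (fun y : R => y ^ 2)). auto_derive; easy.
      + apply (continuous_comp (fun r => r / 2 * bB d 1 r) (fun y => y ^ 2)).
        * apply (continuous_mult (fun r => r / 2) (bB d 1)); [|now apply continuous_bB].
          apply (ex_derive_continuous (fun r : R => r / 2)). auto_derive; easy.
        * apply (ex_derive_continuous (fun y : R => y ^ 2)). auto_derive; easy.
    - intros x Hx. pose proof (bA_plus_pos d x Hd). pose proof (bB_plus_pos d x Hd).
      assert (0 < x / 2 * bB d 1 x) by (apply Rmult_lt_0_compat; lra).
      eapply is_derive_value.
      + apply (is_derive_Rminus (fun r => bA d 1 r ^ 2) (fun r => (r / 2 * bB d 1 r) ^ 2)).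
        * apply (is_derive_Rpow (bA d 1)); [lra | now apply is_derive_bA].
        * apply (is_derive_Rpow (fun r => r / 2 * bB d 1 r)); [lra|].
          apply (is_derive_Rmult (fun r => r / 2) (bB d 1)).
          -- apply (is_derive_Rdiv (fun r => r) (fun _ => 2)); [lra | apply is_derive_Rid |
               apply is_derive_Rcst].
          -- apply is_derive_bB; [easy | lra].
      + simpl INR. field. lra.
    - intros x Hx. apply INR_ge4 in Hd. pose proof (pow2_ge_0 (bB d 1 x)).
      apply Rmult_le_pos; nra. }
  pose proof (bA_0_pos d 1 Hd). pose proof (bA_plus_pos d r Hd).
  pose proof (bB_plus_pos d r Hd).
  assert (r / 2 * bB d 1 r < bA d 1 r) by nra.
  unfold bQ, bW. replace (r / 2 * (bB d 1 r / bA d 1 r)) with (r / 2 * bB d 1 r / bA d 1 r)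
    by (field; lra).
  apply Rlt_div_l; lra.
Qed.

Lemma BesselJ_bA (d : nat) (r : R) :
  0 < r -> BesselJ (nu_of d) r = bA d (-1) r * Rpower (r / 2) (nu_of d).
Proof.
  intros Hr. rewrite BesselJ_clifford by easy. unfold bA.
  now replace (-1 * (r ^ 2 / 4)) with (- (r ^ 2 / 4)) by ring.
Qed.

(** It holds at the zeros of J_nu as well: both sides are then 0, since the inverse of 0 is 0. *)
Lemma BesselJ_ratio (d : nat) (r : R) :
  0 < r -> BesselJ (nu_of d + 1) r / BesselJ (nu_of d) r = bP d r.
Proof.
  intros Hr. rewrite !BesselJ_clifford by easy.
  rewrite Rpower_plus, (Rpower_1 (r / 2)) by lra.
  unfold bP, bW, bA, bB.
  replace (-1 * (r ^ 2 / 4)) with (- (r ^ 2 / 4)) by ring.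
  assert (0 < Rpower (r / 2) (nu_of d)) by apply exp_pos.
  unfold Rdiv. rewrite Rinv_mult.
  match goal with |- ?x * (?p * ?h) * (?y * ?q) = _ =>
    replace (x * (p * h) * (y * q)) with (h * (x * y) * (p * q)) by ring end.
  rewrite Rinv_r by lra. ring.
Qed.

Lemma BesselI_ratio (d : nat) (r : R) :
  0 < r -> BesselI (nu_of d + 1) r / BesselI (nu_of d) r = bQ d r.
Proof.
  intros Hr. rewrite !BesselI_clifford by easy.
  rewrite Rpower_plus, (Rpower_1 (r / 2)) by lra.
  unfold bQ, bW, bA, bB. rewrite Rmult_1_l.
  assert (0 < Rpower (r / 2) (nu_of d)) by apply exp_pos.
  unfold Rdiv. rewrite Rinv_mult.
  match goal with |- ?x * (?p * ?h) * (?y * ?q) = _ =>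
    replace (x * (p * h) * (y * q)) with (h * (x * y) * (p * q)) by ring end.
  rewrite Rinv_r by lra. ring.
Qed.

Definition bf (d : nat) (r : R) : R := r ^ (d - 1) * (bP d r + bQ d r).
Definition bg (d : nat) (r : R) : R := / r ^ (d - 1) * (bP d r - bQ d r).

Lemma f_nu_bf (d : nat) (r : R) : (4 <= d)%nat -> 0 <= r -> f_nu d r = bf d r.
Proof.
  intros Hd [Hr|Hr]; unfold f_nu, bf.
  - now rewrite BesselJ_ratio, BesselI_ratio.
  (* At r = 0 the power r^(d-1) vanishes, whatever values the ratios take there. *)
  - subst r. rewrite pow_i by lia. ring.
Qed.

Lemma g_nu_bg (d : nat) (r : R) : 0 < r -> g_nu d r = bg d r.
Proof. intros Hr. unfold g_nu, bg. now rewrite BesselJ_ratio, BesselI_ratio. Qed.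

Lemma bf_mul_bg (d : nat) (r : R) : 0 < r -> bf d r * bg d r = bP d r ^ 2 - bQ d r ^ 2.
Proof.
  intros Hr. unfold bf, bg. pose proof (pow_lt r (d - 1) Hr). field. lra.
Qed.

Lemma is_derive_bf (d : nat) (r : R) :
  (4 <= d)%nat -> 0 < r -> bA d (-1) r <> 0 ->
  is_derive (bf d) r (r ^ (d - 1) * (2 + bP d r ^ 2 - bQ d r ^ 2)).
Proof.
  intros Hd Hr HA. eapply is_derive_value.
  - apply (is_derive_Rmult (fun r => r ^ (d - 1)) (fun r => bP d r + bQ d r)).
    + apply (is_derive_Rpow (fun r => r)); [lra | apply is_derive_Rid].
    + apply is_derive_Rplus; [now apply is_derive_bP | now apply is_derive_bQ].
  - rewrite INR_pred by easy. field. lra.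
Qed.

Lemma is_derive_bg (d : nat) (r : R) :
  (4 <= d)%nat -> 0 < r -> bA d (-1) r <> 0 ->
  is_derive (bg d) r (/ r ^ (d - 1) * (bP d r ^ 2 + bQ d r ^ 2
                       - 2 * (INR d - 1) / r * (bP d r - bQ d r))).
Proof.
  intros Hd Hr HA. pose proof (pow_lt r (d - 1) Hr). eapply is_derive_value.
  - apply (is_derive_Rmult (fun r => / r ^ (d - 1)) (fun r => bP d r - bQ d r)).
    + apply (is_derive_Rinv (fun r => r ^ (d - 1))); [lra|].
      apply (is_derive_Rpow (fun r => r)); [lra | apply is_derive_Rid].
    + apply is_derive_Rminus; [now apply is_derive_bP | now apply is_derive_bQ].
  - rewrite INR_pred by easy. field. lra.
Qed.

Lemma bf_nondecreasing (d : nat) (x y : R) :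
  (4 <= d)%nat -> 0 < x <= y -> (forall r, x <= r <= y -> bA d (-1) r <> 0) ->
  bf d x <= bf d y.
Proof.
  intros Hd [Hx Hy] HA.
  apply (nondecreasing_of_derive (bf d)
    (fun r => r ^ (d - 1) * (2 + bP d r ^ 2 - bQ d r ^ 2))); [easy | | |].
  - intros r Hr. eapply continuous_of_derive. apply is_derive_bf; [easy | lra | auto].
  - intros r Hr. apply is_derive_bf; [easy | lra | apply HA; lra].
  - intros r Hr. pose proof (pow_lt r (d - 1) ltac:(lra)).
    pose proof (bQ_pos d r Hd ltac:(lra)). pose proof (bQ_lt1 d r Hd ltac:(lra)).
    apply Rmult_le_pos; [lra|]. nra.
Qed.

(** * The functions b and K *)

Lemma pow_lt_one (a : R) (d : nat) : (4 <= d)%nat -> 0 <= a < 1 -> a ^ d < 1.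
Proof.
  intros Hd Ha. destruct d as [|d]; [lia|]. simpl.
  assert (a ^ d <= 1) by (rewrite <- (pow1 d); apply pow_incr; lra).
  pose proof (pow_le a d ltac:(lra)). nra.
Qed.

Lemma pow_split (x : R) (d : nat) : (4 <= d)%nat -> x ^ d = x * x ^ (d - 1).
Proof. intros Hd. destruct d as [|d]; [lia|]. simpl. now rewrite Nat.sub_0_r. Qed.

Lemma pow_le_reg (x y : R) (d : nat) : 0 <= y -> x ^ S d <= y ^ S d -> x <= y.
Proof.
  intros Hy H. apply Rnot_lt_le. intros Hlt.
  pose proof (pow_incr y x d ltac:(lra)). pose proof (pow_le y d Hy).
  assert (0 < x ^ d) by (apply pow_lt; lra).
  simpl in H. nra.
Qed.

Lemma b_of_ge0 (d : nat) (a : R) : 0 <= b_of d a.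
Proof. apply rpow_ge0. Qed.

Lemma b_of_pow (d : nat) (a : R) : (4 <= d)%nat -> 0 <= a <= 1 -> b_of d a ^ d = 1 - a ^ d.
Proof.
  intros Hd [Ha [H1|H1]]; unfold b_of.
  - pose proof (pow_lt_one a d Hd ltac:(lra)).
    rewrite rpow_pos by lra. rewrite <- Rpower_pow by apply exp_pos.
    pose proof (INR_ge4 d Hd).
    rewrite Rpower_mult, Rinv_l, Rpower_1; lra.
  - subst a. rewrite pow1, rpow_nonpos by lra. rewrite pow_i by lia. lra.
Qed.

Lemma b_of_pos (d : nat) (a : R) : (4 <= d)%nat -> 0 <= a < 1 -> 0 < b_of d a.
Proof.
  intros Hd Ha. unfold b_of. pose proof (pow_lt_one a d Hd Ha).
  rewrite rpow_pos by lra. apply exp_pos.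
Qed.

Lemma b_of_0 (d : nat) : (4 <= d)%nat -> b_of d 0 = 1.
Proof.
  intros Hd. unfold b_of. rewrite pow_i by lia. rewrite Rminus_0_r, rpow_pos by lra.
  unfold Rpower. now rewrite ln_1, Rmult_0_r, exp_0.
Qed.

Lemma b_of_1 (d : nat) : b_of d 1 = 0.
Proof. unfold b_of. rewrite pow1. apply rpow_nonpos. lra. Qed.

Lemma b_of_decreasing (d : nat) (x y : R) :
  (4 <= d)%nat -> 0 <= x <= y -> y <= 1 -> b_of d y <= b_of d x.
Proof.
  intros Hd Hx Hy. apply pow_le_reg with (d - 1)%nat; [apply b_of_ge0|].
  replace (S (d - 1)) with d by lia. rewrite !b_of_pow by (easy || lra).
  pose proof (pow_incr x y d ltac:(lra)). lra.
Qed.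

Lemma b_of_strict_decreasing (d : nat) (x y : R) :
  (4 <= d)%nat -> 0 <= x < y -> y <= 1 -> b_of d y < b_of d x.
Proof.
  intros Hd Hx Hy. destruct (b_of_decreasing d x y Hd ltac:(lra) Hy) as [H|H]; [easy|].
  exfalso. apply (f_equal (fun z => z ^ d)) in H. rewrite !b_of_pow in H by (easy || lra).
  assert (y <= x); [|lra]. apply pow_le_reg with (d - 1)%nat; [lra|].
  replace (S (d - 1)) with d by lia. lra.
Qed.

Lemma b_of_le1 (d : nat) (a : R) : (4 <= d)%nat -> 0 <= a <= 1 -> b_of d a <= 1.
Proof.
  intros Hd Ha. rewrite <- (b_of_0 d Hd). apply b_of_decreasing; [easy | lra | lra].
Qed.

Lemma continuous_pow_fun (n : nat) (x : R) : continuous (fun t : R => t ^ n) x.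
Proof. apply (ex_derive_continuous (fun t : R => t ^ n)). auto_derive; easy. Qed.

Lemma continuous_b_of (d : nat) (a : R) : (4 <= d)%nat -> continuous (b_of d) a.
Proof.
  intros Hd. unfold b_of.
  apply (continuous_comp (fun t => 1 - t ^ d) (fun t => rpow t (/ INR d))).
  - apply (continuous_minus (fun _ => 1) (fun t => t ^ d)); [apply continuous_const|].
    apply continuous_pow_fun.
  - apply continuous_rpow. apply Rinv_0_lt_compat. pose proof (INR_ge4 d Hd). lra.
Qed.

Lemma is_derive_b_of (d : nat) (a : R) :
  (4 <= d)%nat -> 0 < a < 1 ->
  is_derive (b_of d) a (- (a ^ (d - 1) / b_of d a ^ (d - 1))).
Proof.
  intros Hd Ha. pose proof (INR_ge4 d Hd) as HD.
  pose proof (pow_lt_one a d Hd ltac:(lra)) as Hp.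
  pose proof (b_of_pos d a Hd ltac:(lra)) as Hb.
  eapply is_derive_value.
  - apply (is_derive_Rcomp (fun t => rpow t (/ INR d)) (fun t => 1 - t ^ d)).
    + apply is_derive_rpow. lra.
    + apply (is_derive_Rminus (fun _ => 1) (fun t => t ^ d)); [apply is_derive_Rcst|].
      apply (is_derive_Rpow (fun t => t)); [lra | apply is_derive_Rid].
  (* Real exponents are confined to this identity: as 1 - a^d = b^d, the power with exponent 1/d - 1
     is b^(1-d). *)
  - assert (E : rpow (1 - a ^ d) (/ INR d - 1) * b_of d a ^ d = b_of d a).
    { rewrite b_of_pow by (easy || lra). unfold b_of. rewrite !rpow_pos by lra.
      rewrite <- (Rpower_1 (1 - a ^ d)) at 2 by lra. rewrite <- Rpower_plus. f_equal. ring. }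
    rewrite (pow_split (b_of d a) d Hd) in E.
    pose proof (pow_lt (b_of d a) (d - 1) Hb) as Hbp.
    assert (E' : rpow (1 - a ^ d) (/ INR d - 1) = / b_of d a ^ (d - 1)).
    { apply Rmult_eq_reg_r with (b_of d a * b_of d a ^ (d - 1)).
      - rewrite E. field. lra.
      - apply Rgt_not_eq. nra. }
    rewrite E', (pow_split a d Hd). field. lra.
Qed.

Lemma K_of_denom_pos (d : nat) (a : R) : 0 < 1 + b_of d a ^ (d - 1).
Proof. pose proof (pow_le (b_of d a) (d - 1) (b_of_ge0 d a)). lra. Qed.

Lemma K_of_0 (d : nat) : (4 <= d)%nat -> K_of d 0 = 0.
Proof. intros Hd. unfold K_of. rewrite pow_i by lia. unfold Rdiv. ring. Qed.

Lemma K_of_1 (d : nat) : (4 <= d)%nat -> K_of d 1 = 1.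
Proof. intros Hd. unfold K_of. rewrite b_of_1, pow1, pow_i by lia. field. Qed.

Lemma K_of_pos (d : nat) (a : R) : 0 < a -> 0 < K_of d a.
Proof. intros Ha. apply Rdiv_lt_0_compat; [now apply pow_lt | apply K_of_denom_pos]. Qed.

Lemma K_of_increasing (d : nat) (x y : R) :
  (4 <= d)%nat -> 0 <= x <= y -> y <= 1 -> 0 <= K_of d x <= K_of d y.
Proof.
  intros Hd Hx Hy. pose proof (K_of_denom_pos d x). pose proof (K_of_denom_pos d y).
  pose proof (pow_le x (d - 1) ltac:(lra)).
  split.
  - apply Rmult_le_pos; [easy|]. left. now apply Rinv_0_lt_compat.
  - apply Rmult_le_compat; [easy | left; now apply Rinv_0_lt_compat | now apply pow_incr |].
    apply Rinv_le_contravar; [easy|]. apply Rplus_le_compat_l, pow_incr.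
    split; [apply b_of_ge0 | now apply b_of_decreasing].
Qed.

Lemma K_of_le1 (d : nat) (a : R) : (4 <= d)%nat -> 0 <= a <= 1 -> K_of d a <= 1.
Proof.
  intros Hd Ha. rewrite <- (K_of_1 d Hd). apply K_of_increasing; [easy | lra | lra].
Qed.

Lemma continuous_K_of (d : nat) (a : R) : (4 <= d)%nat -> continuous (K_of d) a.
Proof.
  intros Hd. pose proof (K_of_denom_pos d a). unfold K_of.
  apply (continuous_mult (fun a => a ^ (d - 1)) (fun a => / (1 + b_of d a ^ (d - 1)))).
  - apply continuous_pow_fun.
  - apply (continuous_comp (fun a => 1 + b_of d a ^ (d - 1)) Rinv).
    + apply (continuous_plus (fun _ => 1) (fun a => b_of d a ^ (d - 1)));
        [apply continuous_const|].
      apply (continuous_comp (b_of d) (fun t => t ^ (d - 1)));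
        [now apply continuous_b_of | apply continuous_pow_fun].
    + apply continuous_Rinv. lra.
Qed.

Lemma aK_strict_increasing (d : nat) (x y : R) :
  (4 <= d)%nat -> 0 <= x < y -> y <= 1 -> x * K_of d x < y * K_of d y.
Proof.
  intros Hd Hx Hy. pose proof (K_of_increasing d x y Hd ltac:(lra) Hy).
  pose proof (K_of_pos d y ltac:(lra)). nra.
Qed.

(** Written through b alone because at [aI] the given data is the value of b. *)
Lemma aK_eq (d : nat) (a : R) :
  (4 <= d)%nat -> 0 <= a <= 1 ->
  a * K_of d a = (1 - b_of d a ^ d) / (1 + b_of d a ^ (d - 1)).
Proof.
  intros Hd Ha. rewrite b_of_pow by easy. unfold K_of. rewrite (pow_split a d Hd).
  pose proof (K_of_denom_pos d a). field. lra.
Qed.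

(* the logarithmic derivative a K'(a) / K(a) *)
Definition kappa (d : nat) (a : R) : R :=
  (INR d - 1) * (1 + a ^ d / (b_of d a + b_of d a ^ d)).

Lemma is_derive_K_of (d : nat) (a : R) :
  (4 <= d)%nat -> 0 < a < 1 -> is_derive (K_of d) a (K_of d a * kappa d a / a).
Proof.
  intros Hd Ha. pose proof (K_of_denom_pos d a) as HK.
  pose proof (b_of_pos d a Hd ltac:(lra)) as Hb.
  pose proof (pow_lt (b_of d a) (d - 1) Hb) as Hbp.
  eapply is_derive_value.
  - apply (is_derive_Rdiv (fun a => a ^ (d - 1)) (fun a => 1 + b_of d a ^ (d - 1))); [lra | |].
    + apply (is_derive_Rpow (fun t => t)); [lra | apply is_derive_Rid].
    + apply (is_derive_Rplus (fun _ => 1) (fun a => b_of d a ^ (d - 1)));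
        [apply is_derive_Rcst|].
      apply (is_derive_Rpow (b_of d)); [lra | now apply is_derive_b_of].
  - unfold kappa, K_of. rewrite (pow_split a d Hd), (pow_split (b_of d a) d Hd).
    rewrite INR_pred by easy. field.
    repeat split; try lra; apply Rgt_not_eq; nra.
Qed.

Lemma kappa_ge0 (d : nat) (a : R) : (4 <= d)%nat -> 0 <= a < 1 -> 0 <= kappa d a.
Proof.
  intros Hd Ha. pose proof (INR_ge4 d Hd). pose proof (b_of_pos d a Hd Ha) as Hb.
  pose proof (pow_lt (b_of d a) d Hb). pose proof (pow_le a d ltac:(lra)).
  apply Rmult_le_pos; [lra|].
  assert (0 <= a ^ d / (b_of d a + b_of d a ^ d)); [|lra].
  apply Rmult_le_pos; [easy|]. left. apply Rinv_0_lt_compat. lra.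
Qed.

Lemma kappa_increasing (d : nat) (x y : R) :
  (4 <= d)%nat -> 0 <= x <= y -> y < 1 -> kappa d x <= kappa d y.
Proof.
  intros Hd Hx Hy. pose proof (INR_ge4 d Hd).
  pose proof (b_of_pos d x Hd ltac:(lra)) as Hbx.
  pose proof (b_of_pos d y Hd ltac:(lra)) as Hby.
  pose proof (b_of_decreasing d x y Hd Hx ltac:(lra)) as Hb.
  pose proof (pow_lt _ d Hbx). pose proof (pow_lt _ d Hby).
  pose proof (pow_incr (b_of d y) (b_of d x) d ltac:(lra)).
  apply Rmult_le_compat_l; [lra|]. apply Rplus_le_compat_l.
  apply Rmult_le_compat; [apply pow_le; lra | left; apply Rinv_0_lt_compat; lra |
    now apply pow_incr |].
  apply Rinv_le_contravar; lra.
Qed.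

Lemma K'_of_eq (d : nat) (a : R) :
  (4 <= d)%nat -> 0 < a < 1 -> K'_of d a = K_of d a * kappa d a / a.
Proof. intros Hd Ha. apply is_derive_unique. now apply is_derive_K_of. Qed.

Lemma is_derive_scaled_aK (d : nat) (k a : R) :
  (4 <= d)%nat -> 0 < a < 1 ->
  is_derive (fun a => k * K_of d a * a) a (k * K_of d a * (1 + kappa d a)).
Proof.
  intros Hd Ha. eapply is_derive_value.
  - apply (is_derive_Rmult (fun a => k * K_of d a) (fun a => a)); [|apply is_derive_Rid].
    apply (is_derive_Rmult (fun _ => k) (K_of d)); [apply is_derive_Rcst|].
    now apply is_derive_K_of.
  - field. lra.
Qed.

Lemma is_derive_scaled_b (d : nat) (k a : R) :
  (4 <= d)%nat -> 0 < a < 1 ->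
  is_derive (fun a => k * b_of d a) a (- k * (a ^ (d - 1) / b_of d a ^ (d - 1))).
Proof.
  intros Hd Ha. eapply is_derive_value.
  - apply (is_derive_Rmult (fun _ => k) (b_of d)); [apply is_derive_Rcst|].
    now apply is_derive_b_of.
  - ring.
Qed.

Lemma continuous_scaled_aK (d : nat) (k a : R) :
  (4 <= d)%nat -> continuous (fun a => k * K_of d a * a) a.
Proof.
  intros Hd. apply (continuous_mult (fun a => k * K_of d a) (fun a => a));
    [|apply continuous_id].
  apply (continuous_scal_r k (K_of d)). now apply continuous_K_of.
Qed.

Lemma continuous_scaled_b (d : nat) (k a : R) :
  (4 <= d)%nat -> continuous (fun a => k * b_of d a) a.
Proof. intros Hd. apply (continuous_scal_r k (b_of d)). now apply continuous_b_of. Qed.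

(** The powers in [g_nu] cancel against K(a) / a^(d-1) = 1 / (1 + b^(d-1)). What remains is a
    product whose factors can be compared one by one at two points. *)
Lemma G1_eq (d : nat) (k a : R) :
  (4 <= d)%nat -> 0 < k -> 0 < a < 1 ->
  G1 d k a = (1 + kappa d a) * (bP d (k * K_of d a * a) - bQ d (k * K_of d a * a))
             / (1 + b_of d a ^ (d - 1)).
Proof.
  intros Hd Hk Ha. unfold G1. rewrite K'_of_eq by easy.
  pose proof (K_of_pos d a ltac:(lra)) as HK.
  replace (k * a * K_of d a) with (k * K_of d a * a) by ring.
  rewrite g_nu_bg by (apply Rmult_lt_0_compat; [apply Rmult_lt_0_compat|]; lra).
  unfold bg. rewrite (Rpow_mult_distr (k * K_of d a) a).
  assert (0 < (k * K_of d a) ^ (d - 1)) by (apply pow_lt, Rmult_lt_0_compat; lra).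
  assert (0 < a ^ (d - 1)) by (apply pow_lt; lra).
  set (D := bP d (k * K_of d a * a) - bQ d (k * K_of d a * a)).
  replace ((a * (K_of d a * kappa d a / a) + K_of d a) * (k * K_of d a) ^ (d - 1)
    * (/ ((k * K_of d a) ^ (d - 1) * a ^ (d - 1)) * D))
    with ((1 + kappa d a) * D * (K_of d a / a ^ (d - 1))) by (field; lra).
  unfold K_of at 1. pose proof (K_of_denom_pos d a). field. lra.
Qed.

Lemma partition_locate (x : nat -> R) (a : R) (n : nat) :
  x 0%nat <= a < x (S n) -> exists i, (i <= n)%nat /\ x i <= a < x (S i).
Proof.
  induction n as [|n IH]; intros H.
  - now exists 0%nat.
  - destruct (Rlt_le_dec a (x (S n))) as [H1|H1].
    + destruct IH as [i [Hi Hi']]; [lra|]. exists i. split; [lia|easy].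
    + exists (S n). split; [lia|lra].
Qed.

Lemma partition_monotone (x : nat -> R) (n i j : nat) :
  (forall i, (i <= n)%nat -> x i < x (S i)) -> (i <= j)%nat -> (j <= S n)%nat -> x i <= x j.
Proof.
  intros Hx Hij. induction Hij as [|j Hij IH]; intros Hj; [lra|].
  specialize (Hx j ltac:(lia)). specialize (IH ltac:(lia)). lra.
Qed.

(** * The first zeros of J_nu and f_nu *)

Lemma no_zero_same_sign (h : R -> R) (a b : R) :
  a <= b -> (forall x, continuous h x) -> (forall x, a <= x <= b -> h x <> 0) ->
  0 < h a -> 0 < h b.
Proof.
  intros Hab Hc Hn Ha. apply Rnot_le_lt. intros Hb.
  destruct (IVT_gen h a b 0) as [x [Hx Hx0]].
  - intros x. apply continuity_pt_filterlim, Hc.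
  - rewrite Rmin_right, Rmax_left by lra. lra.
  - rewrite Rmin_left, Rmax_right in Hx by lra. now apply (Hn x).
Qed.

Lemma bA_minus_zero (d : nat) (j : R) :
  first_pos_zero (BesselJ (nu_of d)) j -> bA d (-1) j = 0.
Proof.
  intros [Hj [Hz _]]. rewrite BesselJ_bA in Hz by easy.
  assert (0 < Rpower (j / 2) (nu_of d)) by apply exp_pos.
  apply Rmult_integral in Hz. lra.
Qed.

Lemma bA_minus_pos (d : nat) (j r : R) :
  (4 <= d)%nat -> first_pos_zero (BesselJ (nu_of d)) j -> 0 <= r < j ->
  0 < bA d (-1) r.
Proof.
  intros Hd [Hj [_ Hn]] Hr.
  apply (no_zero_same_sign (bA d (-1)) 0); [lra | | |now apply bA_0_pos].
  - intros x. now apply continuous_bA.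
  - intros x [[Hx|Hx] Hxr] E.
    + apply (Hn x); [lra|]. rewrite BesselJ_bA by easy. rewrite E. ring.
    + subst x. generalize (bA_0_pos d (-1) Hd). lra.
Qed.

(** Up to a constant r^d B is r^(nu+1) J_{nu+1}, a primitive of r^(nu+1) J_nu, and J_nu is positive
    before [j]. *)
Lemma bB_minus_pos (d : nat) (j r : R) :
  (4 <= d)%nat -> first_pos_zero (BesselJ (nu_of d)) j -> 0 <= r <= j ->
  0 < bB d (-1) r.
Proof.
  intros Hd Hj [[Hr|Hr] Hrj].
  2: { subst r. rewrite bB_0. apply clifford_pos; [apply nu_of_pos in Hd|]; lra. }
  assert (H : 0 ^ d * bB d (-1) 0 < r ^ d * bB d (-1) r).
  { apply (increasing_of_derive (fun r => r ^ d * bB d (-1) r)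
      (fun r => r ^ d / r * (2 * bA d (-1) r))); [easy | | |].
    - intros x _. apply (continuous_mult (fun r => r ^ d) (bB d (-1)));
        [|now apply continuous_bB].
      apply (ex_derive_continuous (fun r : R => r ^ d)). auto_derive; easy.
    - intros x Hx. eapply is_derive_value.
      + apply (is_derive_Rmult (fun r => r ^ d) (bB d (-1))).
        * apply (is_derive_Rpow (fun r => r)); [lra | apply is_derive_Rid].
        * apply is_derive_bB; [easy | lra].
      + field. lra.
    - intros x Hx. pose proof (bA_minus_pos d j x Hd Hj ltac:(lra)).
      apply Rmult_lt_0_compat; [|lra].
      apply Rdiv_lt_0_compat; [apply pow_lt|]; lra. }
  rewrite pow_i in H by lia. pose proof (pow_lt r d Hr). nra.
Qed.

(** Up to a power of r/2, the cross product J_{nu+1} I_nu + I_{nu+1} J_nu of the clamped plate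
    problem: the numerator of p + q, smooth through [j]. *)
Definition bS (d : nat) (r : R) : R := bB d (-1) r * bA d 1 r + bB d 1 r * bA d (-1) r.

Lemma bP_plus_bQ (d : nat) (r : R) :
  (4 <= d)%nat -> bA d (-1) r <> 0 ->
  bP d r + bQ d r = r / 2 * (bS d r / (bA d (-1) r * bA d 1 r)).
Proof.
  intros Hd HA. pose proof (bA_plus_pos d r Hd).
  unfold bP, bQ, bW, bS. field. lra.
Qed.

Lemma continuous_bS (d : nat) (r : R) : (4 <= d)%nat -> continuous (bS d) r.
Proof.
  intros Hd. apply (continuous_plus (fun r => bB d (-1) r * bA d 1 r)
                     (fun r => bB d 1 r * bA d (-1) r)).
  - apply (continuous_mult (bB d (-1)) (bA d 1));
      [now apply continuous_bB | now apply continuous_bA].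
  - apply (continuous_mult (bB d 1) (bA d (-1)));
      [now apply continuous_bB | now apply continuous_bA].
Qed.

Lemma bP_pos (d : nat) (j r : R) :
  (4 <= d)%nat -> first_pos_zero (BesselJ (nu_of d)) j -> 0 < r < j -> 0 < bP d r.
Proof.
  intros Hd Hj Hr. unfold bP, bW. apply Rmult_lt_0_compat; [lra|].
  apply Rdiv_lt_0_compat; [eapply bB_minus_pos | eapply bA_minus_pos]; eauto; lra.
Qed.

(** The endpoint [r = j] is included so that the zero [k] cannot coincide with [j]. *)
Lemma bf_pos (d : nat) (j r : R) :
  (4 <= d)%nat -> first_pos_zero (BesselJ (nu_of d)) j -> 0 < r <= j -> 0 < bf d r.
Proof.
  intros Hd Hj [Hr [Hrj|Hrj]]; pose proof (bQ_pos d r Hd Hr);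
    (apply Rmult_lt_0_compat; [apply pow_lt; lra|]).
  - pose proof (bP_pos d j r Hd Hj ltac:(lra)). lra.
  - (* [r = j]: the division by [A(-j^2/4) = 0] yields [0] *)
    assert (E : bP d r = 0); [|lra].
    unfold bP, bW. rewrite Hrj, bA_minus_zero by easy. unfold Rdiv. rewrite Rinv_0. ring.
Qed.

Lemma exp_INR_mult (n : nat) (y : R) : exp (INR n * y) = exp y ^ n.
Proof.
  induction n as [|n IH].
  - simpl. now rewrite Rmult_0_l, exp_0.
  - rewrite S_INR, Rmult_plus_distr_r, exp_plus, IH, Rmult_1_l. simpl. ring.
Qed.

(** Supplies rational lower bounds for the exponentials in the comparison of [j] with [k]; it is 1 +
    t <= exp t raised to the n-th power. *)
Lemma exp_neg_lower (x : R) (n : nat) :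
  0 <= x < INR n -> (1 - x / INR n) ^ n <= exp (- x).
Proof.
  intros Hx.
  replace (- x) with (INR n * (- x / INR n)) by (field; lra).
  rewrite exp_INR_mult. apply pow_incr. split.
  - assert (x / INR n <= 1); [|lra]. apply Rle_div_l; lra.
  - generalize (exp_ineq1_le (- x / INR n)). unfold Rdiv. lra.
Qed.

Section FirstZeros.

Variables (d : nat) (j k : R).
Hypothesis Hd : (4 <= d)%nat.
Hypothesis Hj : first_pos_zero (BesselJ (nu_of d)) j.
Hypothesis Hk : first_pos_zero (f_nu d) k.

Lemma j_pos : 0 < j.
Proof. apply Hj. Qed.

Lemma bf_k : bf d k = 0.
Proof. destruct Hk as [Hk0 [Hz _]]. rewrite f_nu_bf in Hz; [easy | easy | lra]. Qed.

Lemma j_lt_k : j < k.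
Proof.
  apply Rnot_le_lt. intros H. destruct Hk as [Hk0 _].
  generalize (bf_pos d j k Hd Hj ltac:(lra)). rewrite bf_k. lra.
Qed.

(** At [j] the value is B_- A_+ > 0, and the sign persists: a zero of S before [k] would be a zero
    of [f_nu], unless A_- vanishes there too. *)
Lemma bS_pos (r : R) : j <= r < k -> 0 < bS d r.
Proof.
  intros Hr. pose proof j_pos as Hj0.
  assert (HBj : 0 < bB d (-1) j) by (eapply bB_minus_pos; eauto; lra).
  apply (no_zero_same_sign (bS d) j); [lra | | |].
  - intros x. now apply continuous_bS.
  - intros x Hx E. destruct (Req_dec (bA d (-1) x) 0) as [HA|HA].
    + (* a zero of A is simple since the Turan determinant is positive from j on *)
      pose proof (turan_scaled_monotone d (-1) j x Hd ltac:(lra)) as H.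
      unfold turan in H. rewrite (bA_minus_zero d j Hj), HA in H.
      unfold bS in E. rewrite HA in E. pose proof (bA_plus_pos d x Hd).
      assert (EB : bB d (-1) x = 0) by nra. rewrite EB in H.
      pose proof (pow_lt j (d + 2) Hj0).
      assert (0 < j ^ (d + 2) * (bB d (-1) j ^ 2 - 0 * bC d (-1) j)).
      { apply Rmult_lt_0_compat; [easy|]. nra. }
      nra.
    + destruct Hk as [_ [_ Hn]]. apply (Hn x); [lra|].
      rewrite f_nu_bf by (easy || lra). unfold bf.
      rewrite bP_plus_bQ, E by easy. unfold Rdiv. ring.
  - unfold bS. rewrite (bA_minus_zero d j Hj). pose proof (bA_plus_pos d j Hd). nra.
Qed.

(** The derivative of A_- / A_+ is - r S / (2 A_+^2), negative between [j] and [k]; so J_nu has no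
    second zero up to [k]. *)
Lemma bA_minus_neg (r : R) : j < r <= k -> bA d (-1) r < 0.
Proof.
  intros Hr. pose proof j_pos as Hj0.
  assert (H : - (bA d (-1) j / bA d 1 j) < - (bA d (-1) r / bA d 1 r)).
  { apply (increasing_of_derive (fun r => - (bA d (-1) r / bA d 1 r))
      (fun r => r / 2 * bS d r / bA d 1 r ^ 2)); [lra | | |].
    - intros x _. pose proof (bA_plus_pos d x Hd). eapply continuous_of_derive.
      apply is_derive_Ropp.
      apply (is_derive_Rdiv (bA d (-1)) (bA d 1)); [lra | now apply is_derive_bA |
        now apply is_derive_bA].
    - intros x _. pose proof (bA_plus_pos d x Hd). eapply is_derive_value.
      + apply is_derive_Ropp.
        apply (is_derive_Rdiv (bA d (-1)) (bA d 1)); [lra | now apply is_derive_bA |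
          now apply is_derive_bA].
      + unfold bS. field. lra.
    - intros x Hx. pose proof (bA_plus_pos d x Hd). pose proof (bS_pos x ltac:(lra)).
      apply Rdiv_lt_0_compat; [|now apply pow_lt]. apply Rmult_lt_0_compat; lra. }
  rewrite (bA_minus_zero d j Hj) in H. pose proof (bA_plus_pos d r Hd) as Hp.
  unfold Rdiv in H. rewrite Rmult_0_l in H.
  apply Rinv_0_lt_compat in Hp. nra.
Qed.

Lemma bA_minus_nonzero (r : R) : 0 <= r <= k -> r <> j -> bA d (-1) r <> 0.
Proof.
  intros Hr Hrj. destruct (Rlt_le_dec r j) as [H|H].
  - generalize (bA_minus_pos d j r Hd Hj ltac:(lra)). lra.
  - generalize (bA_minus_neg r ltac:(lra)). lra.
Qed.

Lemma bS_k : bS d k = 0.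
Proof.
  pose proof bf_k as H. pose proof j_pos. pose proof j_lt_k.
  pose proof (bA_minus_neg k ltac:(lra)) as HA. pose proof (bA_plus_pos d k Hd).
  unfold bf in H. pose proof (pow_lt k (d - 1) ltac:(lra)).
  apply Rmult_integral in H. destruct H as [H|H]; [lra|].
  rewrite bP_plus_bQ in H by (easy || lra).
  replace (bS d k) with (2 / k * (bA d (-1) k * bA d 1 k)
    * (k / 2 * (bS d k / (bA d (-1) k * bA d 1 k)))) by (field; lra).
  rewrite H. ring.
Qed.

Lemma bS_ge0 (r : R) : j <= r <= k -> 0 <= bS d r.
Proof.
  intros [Hr [H|H]]; [left; now apply bS_pos|]. subst r. rewrite bS_k. lra.
Qed.

Lemma bP_plus_bQ_le0 (r : R) : j < r <= k -> bP d r + bQ d r <= 0.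
Proof.
  intros Hr. pose proof j_pos.
  pose proof (bA_minus_neg r Hr). pose proof (bA_plus_pos d r Hd).
  rewrite bP_plus_bQ by (easy || lra). pose proof (bS_ge0 r ltac:(lra)).
  assert (/ (bA d (-1) r * bA d 1 r) < 0) by (apply Rinv_lt_0_compat; nra).
  unfold Rdiv at 2.
  assert (0 <= r / 2 * bS d r) by (apply Rmult_le_pos; lra). nra.
Qed.

Lemma bf_le0 (r : R) : j < r <= k -> bf d r <= 0.
Proof.
  intros Hr. pose proof j_pos. pose proof (bP_plus_bQ_le0 r Hr).
  pose proof (pow_lt r (d - 1) ltac:(lra)). unfold bf. nra.
Qed.

Lemma bf_monotone_below (x y : R) : 0 < x <= y -> y < j -> bf d x <= bf d y.
Proof.
  intros Hx Hy. pose proof j_lt_k. apply bf_nondecreasing; trivial.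
  intros r Hr. apply bA_minus_nonzero; lra.
Qed.

Lemma bf_monotone_above (x y : R) : j < x <= y -> y <= k -> bf d x <= bf d y.
Proof.
  intros Hx Hy. pose proof j_pos. apply bf_nondecreasing; trivial; [lra|].
  intros r Hr. apply bA_minus_nonzero; lra.
Qed.

(** In the derivative p^2 + q^2 - 2 (d-1) (p - q) / r, up to a positive factor, the last term helps:
    p <= -q < 0 beyond [j] makes p - q negative. *)
Lemma bg_monotone_above (x y : R) : j < x <= y -> y <= k -> bg d x <= bg d y.
Proof.
  intros Hx Hy. pose proof j_pos.
  assert (HA : forall r, x <= r <= y -> bA d (-1) r <> 0).
  { intros r Hr. apply bA_minus_nonzero; lra. }
  apply (nondecreasing_of_derive (bg d) (fun r => / r ^ (d - 1) * (bP d r ^ 2 + bQ d r ^ 2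
                       - 2 * (INR d - 1) / r * (bP d r - bQ d r)))); [lra | | |].
  - intros r Hr. eapply continuous_of_derive. apply is_derive_bg; [easy | lra | auto].
  - intros r Hr. apply is_derive_bg; [easy | lra | apply HA; lra].
  - intros r Hr. apply Rmult_le_pos.
    + left. apply Rinv_0_lt_compat, pow_lt. lra.
    + pose proof (bP_plus_bQ_le0 r ltac:(lra)). pose proof (bQ_pos d r Hd ltac:(lra)).
      pose proof (INR_ge4 d Hd).
      assert (0 < 2 * (INR d - 1) / r) by (apply Rdiv_lt_0_compat; lra).
      pose proof (pow2_ge_0 (bP d r)). pose proof (pow2_ge_0 (bQ d r)). nra.
Qed.

(** The two functions agree at 0, and from there one increases while the other decreases. *)
Lemma bW_minus_ge_plus (r : R) : 0 <= r < j -> bW d 1 r <= bW d (-1) r.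
Proof.
  intros Hr. pose proof j_lt_k. apply Rle_trans with (bW d 1 0).
  - apply bW_plus_decreasing; [easy | lra].
  - replace (bW d 1 0) with (bW d (-1) 0) by (unfold bW; now rewrite !bA_0, !bB_0).
    apply bW_minus_increasing; [easy | lra |].
    intros x Hx. apply bA_minus_nonzero; lra.
Qed.

Lemma bP_minus_bQ_monotone (x y : R) :
  0 < x <= y -> y < j -> 0 <= bP d x - bQ d x <= bP d y - bQ d y.
Proof.
  intros Hx Hy. pose proof j_lt_k.
  pose proof (bW_minus_ge_plus x ltac:(lra)).
  pose proof (bW_plus_decreasing d x y Hd ltac:(lra)).
  assert (bW d (-1) x <= bW d (-1) y).
  { apply bW_minus_increasing; [easy | lra |]. intros r Hr. apply bA_minus_nonzero; lra. }
  unfold bP, bQ. split; nra.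
Qed.

Lemma bP2_minus_bQ2_monotone (x y : R) :
  0 < x <= y -> y < j ->
  0 <= bP d x ^ 2 - bQ d x ^ 2 <= bP d y ^ 2 - bQ d y ^ 2.
Proof.
  intros Hx Hy. pose proof j_lt_k.
  pose proof (bP_minus_bQ_monotone x y Hx Hy) as [E1 E2].
  pose proof (bQ_pos d x Hd ltac:(lra)).
  assert (Hs : bP d x ^ 2 - bQ d x ^ 2 <= bP d y ^ 2 - bQ d y ^ 2).
  { assert (W1 : bW d (-1) x <= bW d (-1) y).
    { apply bW_minus_increasing; [easy | lra |]. intros r Hr. apply bA_minus_nonzero; lra. }
    pose proof (bW_plus_decreasing d x y Hd ltac:(lra)) as W2.
    pose proof (bW_minus_ge_plus x ltac:(lra)) as W3.
    assert (W4 : 0 < bW d 1 y).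
    { apply Rdiv_lt_0_compat; [now apply bB_plus_pos | now apply bA_plus_pos]. }
    unfold bP, bQ.
    replace ((x / 2 * bW d (-1) x) ^ 2 - (x / 2 * bW d 1 x) ^ 2)
      with ((x / 2) ^ 2 * (bW d (-1) x ^ 2 - bW d 1 x ^ 2)) by ring.
    replace ((y / 2 * bW d (-1) y) ^ 2 - (y / 2 * bW d 1 y) ^ 2)
      with ((y / 2) ^ 2 * (bW d (-1) y ^ 2 - bW d 1 y ^ 2)) by ring.
    apply Rmult_le_compat; nra. }
  split; [|easy].
  replace (bP d x ^ 2 - bQ d x ^ 2) with ((bP d x - bQ d x) * (bP d x + bQ d x)) by ring.
  apply Rmult_le_pos; lra.
Qed.

Lemma bP2_minus_bQ2_ge0_above (r : R) : j < r <= k -> 0 <= bP d r ^ 2 - bQ d r ^ 2.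
Proof.
  intros Hr. pose proof j_pos. pose proof (bP_plus_bQ_le0 r Hr).
  pose proof (bQ_pos d r Hd ltac:(lra)). nra.
Qed.

(** The function used is r^(d+2) (B_- - C_-) / 2 with [bC] eliminated; its derivative is r^(d+1)
    A_-, positive before [j]. At [j], where A_- = 0, it equals j^d B_- (j^2/2 - d). *)
Lemma first_zero_ge_sqrt : 2 * INR d <= j ^ 2.
Proof.
  pose proof j_pos as Hj0.
  assert (H : 0 ^ d * (2 * bA d (-1) 0 - INR d * bB d (-1) 0 + 0 ^ 2 / 2 * bB d (-1) 0)
     <= j ^ d * (2 * bA d (-1) j - INR d * bB d (-1) j + j ^ 2 / 2 * bB d (-1) j)).
  { apply (nondecreasing_of_derive
      (fun r => r ^ d * (2 * bA d (-1) r - INR d * bB d (-1) r + r ^ 2 / 2 * bB d (-1) r))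
      (fun r => r ^ d * r * bA d (-1) r)); [lra | | |].
    - intros x _.
      pose proof (is_derive_bA d (-1) x Hd) as DA.
      pose proof (is_derive_bB_bC d (-1) x Hd) as DB.
      apply (ex_derive_continuous (fun r => r ^ d * (2 * bA d (-1) r - INR d * bB d (-1) r
        + r ^ 2 / 2 * bB d (-1) r))).
      auto_derive. repeat split; eexists; eassumption.
    - intros x Hx.
      assert (Dx : is_derive (fun r : R => r) x 1) by apply is_derive_Rid.
      pose proof (is_derive_bA d (-1) x Hd) as DA.
      pose proof (is_derive_bB d (-1) x Hd ltac:(lra)) as DB.
      eapply is_derive_value.
      + apply (is_derive_Rmult (fun r => r ^ d) (fun r => 2 * bA d (-1) r
          - INR d * bB d (-1) r + r ^ 2 / 2 * bB d (-1) r)).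
        { apply (is_derive_Rpow (fun r => r)); [lra | exact Dx]. }
        apply (is_derive_Rplus (fun r => 2 * bA d (-1) r - INR d * bB d (-1) r)
                 (fun r => r ^ 2 / 2 * bB d (-1) r)).
        * apply (is_derive_Rminus (fun r => 2 * bA d (-1) r) (fun r => INR d * bB d (-1) r)).
          -- apply (is_derive_Rmult (fun _ => 2) (bA d (-1))); [apply is_derive_Rcst | exact DA].
          -- apply (is_derive_Rmult (fun _ => INR d) (bB d (-1)));
               [apply is_derive_Rcst | exact DB].
        * apply (is_derive_Rmult (fun r => r ^ 2 / 2) (bB d (-1))); [|exact DB].
          apply (is_derive_Rdiv (fun r => r ^ 2) (fun _ => 2));
            [lra | apply (is_derive_Rpow (fun r => r)); [lra | exact Dx] | apply is_derive_Rcst].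
      + simpl (INR 2). field. lra.
    - intros x Hx. pose proof (bA_minus_pos d j x Hd Hj ltac:(lra)).
      pose proof (pow_lt x d ltac:(lra)).
      apply Rmult_le_pos; [|lra]. apply Rmult_le_pos; lra. }
  rewrite (bA_minus_zero d j Hj), (pow_i d) in H by lia.
  pose proof (bB_minus_pos d j j Hd Hj ltac:(lra)) as HB.
  pose proof (pow_lt j d Hj0) as Hp.
  assert (0 <= bB d (-1) j * (j ^ 2 / 2 - INR d)) by nra. nra.
Qed.

(* V = 2A/B is nonincreasing from d to 0 on [0,j] and r V' = d V - V^2 - r^2, so at the
   point where V = d/2 one has r >= d/2. *)
Lemma first_zero_ge_half_dim : INR d / 2 <= j.
Proof.
  pose proof j_pos as Hj0. pose proof (INR_ge4 d Hd) as Hd4.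
  destruct (IVT_gen (fun r => 2 * bA d (-1) r - INR d / 2 * bB d (-1) r) 0 j 0)
    as [r [Hr E]].
  - intros x. apply continuity_pt_filterlim.
    apply (continuous_minus (fun r => 2 * bA d (-1) r) (fun r => INR d / 2 * bB d (-1) r)).
    + apply (continuous_scal_r 2 (bA d (-1))). now apply continuous_bA.
    + apply (continuous_scal_r (INR d / 2) (bB d (-1))). now apply continuous_bB.
  - rewrite (bA_minus_zero d j Hj).
    pose proof (bB_minus_pos d j j Hd Hj ltac:(lra)).
    pose proof (bA_0_pos d (-1) Hd). pose proof (bA_recurrence d (-1) 0 Hd) as R0.
    replace (-1 * (0 ^ 2 / 4)) with 0 in R0 by field.
    rewrite Rmin_right, Rmax_left; nra.
  - rewrite Rmin_left, Rmax_right in Hr by lra.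
    assert (HB : 0 < bB d (-1) r) by (eapply bB_minus_pos; eauto).
    assert (Hr0 : 0 < r).
    { destruct Hr as [[H|H] _]; [easy|]. subst r. exfalso.
      pose proof (bA_0_pos d (-1) Hd). pose proof (bA_recurrence d (-1) 0 Hd) as R0.
      replace (-1 * (0 ^ 2 / 4)) with 0 in R0 by field. nra. }
    pose proof (turan_ge0 d (-1) r Hd Hr0) as HT. unfold turan in HT.
    pose proof (bA_recurrence d (-1) r Hd) as RA.
    assert (EA : bA d (-1) r = INR d / 4 * bB d (-1) r) by lra.
    assert (EC : r ^ 2 * bC d (-1) r = INR d * bB d (-1) r) by lra.
    assert (0 <= r ^ 2 * bB d (-1) r ^ 2 - bA d (-1) r * (r ^ 2 * bC d (-1) r)) by nra.
    rewrite EC, EA in H.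
    assert (0 <= (r ^ 2 - INR d ^ 2 / 4) * bB d (-1) r ^ 2) by nra.
    assert (0 < bB d (-1) r ^ 2) by now apply pow_lt.
    assert (0 <= r ^ 2 - INR d ^ 2 / 4) by nra.
    nra.
Qed.

(* W = -2A/B satisfies W(j) = 0 and r W' = W^2 + d W + r^2 on [j,k]; the hypothesis makes
   -1/(c (W + e)) - ln r nondecreasing there. *)
Lemma zeros_log_ratio (c e : R) :
  0 < c -> 0 < e ->
  (forall w, 0 <= w -> c * (w + e) ^ 2 <= w ^ 2 + INR d * w + j ^ 2) ->
  ln k - ln j < / (c * e).
Proof.
  intros Hc He Hw. pose proof j_pos as Hj0. pose proof j_lt_k as Hjk.
  (* This keeps [w] free of poles up to [k]: beyond [j], S >= 0 and A_- < 0 give B_- A_+ >= - B_+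
     A_- > 0. *)
  assert (HB : forall r, j <= r <= k -> 0 < bB d (-1) r).
  { intros r [[Hr|Hr] Hrk].
    - pose proof (bA_minus_neg r ltac:(lra)). pose proof (bS_ge0 r ltac:(lra)) as HS.
      unfold bS in HS. pose proof (bA_plus_pos d r Hd). pose proof (bB_plus_pos d r Hd). nra.
    - subst r. eapply bB_minus_pos; eauto. lra. }
  pose (w := fun r => -2 * bA d (-1) r / bB d (-1) r).
  assert (Hw0 : forall r, j <= r <= k -> 0 <= w r).
  { intros r Hr. unfold w. pose proof (HB r Hr).
    assert (bA d (-1) r <= 0).
    { destruct Hr as [[Hr|Hr] Hrk].
      - pose proof (bA_minus_neg r ltac:(lra)). lra.
      - subst r. rewrite (bA_minus_zero d j Hj). lra. }
    apply Rmult_le_pos; [lra|]. left; now apply Rinv_0_lt_compat. }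
  assert (Dw : forall r, j <= r <= k ->
    is_derive w r ((w r ^ 2 + INR d * w r + r ^ 2) / r)).
  { intros r Hr. pose proof (HB r Hr). eapply is_derive_value.
    - apply (is_derive_Rdiv (fun r => -2 * bA d (-1) r) (bB d (-1))); [lra | |].
      + apply (is_derive_Rmult (fun _ => -2) (bA d (-1)));
          [apply is_derive_Rcst | now apply is_derive_bA].
      + apply is_derive_bB; [easy | lra].
    - unfold w. field. lra. }
  assert (Dh : forall r, j <= r <= k ->
    is_derive (fun r => - / (c * (w r + e)) - ln r) r
      (((w r ^ 2 + INR d * w r + r ^ 2) / (c * (w r + e) ^ 2) - 1) / r)).
  { intros r Hr. pose proof (Hw0 r Hr). eapply is_derive_value.
    - apply (is_derive_Rminus (fun r => - / (c * (w r + e))) ln).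
      + apply is_derive_Ropp. apply (is_derive_Rinv (fun r => c * (w r + e))).
        * apply Rgt_not_eq, Rmult_lt_0_compat; lra.
        * apply (is_derive_Rmult (fun _ => c) (fun r => w r + e)); [apply is_derive_Rcst|].
          apply (is_derive_Rplus w (fun _ => e)); [now apply Dw | apply is_derive_Rcst].
      + apply is_derive_ln. lra.
    - field. repeat split; lra. }
  assert (H : - / (c * (w j + e)) - ln j <= - / (c * (w k + e)) - ln k).
  { apply (nondecreasing_of_derive (fun r => - / (c * (w r + e)) - ln r)
      (fun r => ((w r ^ 2 + INR d * w r + r ^ 2) / (c * (w r + e) ^ 2) - 1) / r));
      [lra | | |].
    - intros r Hr. eapply continuous_of_derive. now apply Dh.
    - intros r Hr. apply Dh. lra.
    - intros r Hr. pose proof (Hw0 r ltac:(lra)) as Hwr. specialize (Hw _ Hwr).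
      apply Rmult_le_pos; [|left; apply Rinv_0_lt_compat; lra].
      assert (0 < c * (w r + e) ^ 2).
      { apply Rmult_lt_0_compat; [easy|]. apply pow_lt. lra. }
      assert (1 <= (w r ^ 2 + INR d * w r + r ^ 2) / (c * (w r + e) ^ 2)); [|lra].
      apply Rle_div_r; [easy|]. nra. }
  assert (Ej : w j = 0) by (unfold w; rewrite (bA_minus_zero d j Hj); unfold Rdiv; ring).
  rewrite Ej, Rplus_0_l in H. pose proof (Hw0 k ltac:(lra)).
  assert (0 < / (c * (w k + e))) by (apply Rinv_0_lt_compat, Rmult_lt_0_compat; lra).
  lra.
Qed.

Lemma zeros_ratio (c e : R) :
  0 < c -> 0 < e ->
  (forall w, 0 <= w -> c * (w + e) ^ 2 <= w ^ 2 + INR d * w + j ^ 2) ->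
  exp (- / (c * e)) < j / k.
Proof.
  intros Hc He Hw. pose proof (zeros_log_ratio c e Hc He Hw) as H.
  pose proof j_pos as Hj0. pose proof j_lt_k as Hjk.
  rewrite <- (exp_ln (j / k)) by (apply Rdiv_lt_0_compat; lra).
  apply exp_increasing. rewrite ln_div by lra. lra.
Qed.

Lemma zeros_ratio_bound : 1 < 2 * (j / k) ^ d + j / k.
Proof.
  pose proof j_pos as Hj0. pose proof j_lt_k as Hjk.
  pose proof first_zero_ge_sqrt as J1. pose proof first_zero_ge_half_dim as J2.
  assert (Hb : 0 < j / k) by (apply Rdiv_lt_0_compat; lra).
  (* For d >= 7 take c = 1 and e = d/2, admissible by j >= d/2. Then j/k > exp(-2/d), so j/k >
     exp(-2/7) > 3/4 and (j/k)^d >= exp(-2) > 1/8, and 2/8 + 3/4 = 1. *)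
  destruct (Nat.le_gt_cases 7 d) as [H7|H7].
  - assert (H7R : 7 <= INR d) by (apply le_INR in H7; now rewrite (INR_IZR_INZ 7) in H7).
    pose proof (zeros_ratio 1 (INR d / 2) ltac:(lra) ltac:(lra)) as H.
    assert (H' : exp (- (2 / INR d)) < j / k).
    { replace (- (2 / INR d)) with (- / (1 * (INR d / 2))) by (field; lra).
      apply H. intros w Hw. nra. }
    assert (H1 : 3 / 4 < j / k).
    { apply Rle_lt_trans with (2 := H').
      apply Rle_trans with (exp (- (2 / 7))).
      - apply Rle_trans with (2 := exp_neg_lower (2 / 7) 32 ltac:(simpl; lra)).
        rewrite (INR_IZR_INZ 32). simpl. lra.
      - assert (2 / INR d <= 2 / 7).
        { apply Rmult_le_compat_l; [lra|]. apply Rinv_le_contravar; lra. }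
        destruct H0 as [H0|H0]; [left; apply exp_increasing; lra | rewrite H0; lra]. }
    assert (H2 : / 8 <= (j / k) ^ d).
    { apply Rle_trans with (exp (- (2 / INR d)) ^ d).
      - rewrite <- exp_INR_mult. replace (INR d * - (2 / INR d)) with (- (2)) by (field; lra).
        apply Rle_trans with (2 := exp_neg_lower 2 32 ltac:(simpl; lra)).
        rewrite (INR_IZR_INZ 32). simpl. lra.
      - apply pow_incr. split; [left; apply exp_pos | lra]. }
    lra.
  - assert (Ed : d = 4%nat \/ d = 5%nat \/ d = 6%nat) by lia.
    (* For d <= 6 the claim is reduced to a rational certificate: c (w + e)^2 lies below w^2 + d w +
       2 d, hence below the quadratic with j^2, and q is a rational lower bound of exp(-1/(c e)). *)
    assert (Hn : forall (c e q : R), 0 < c -> 0 < e -> 0 <= q ->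
      (forall w, 0 <= w -> c * (w + e) ^ 2 <= w ^ 2 + INR d * w + 2 * INR d) ->
      / (c * e) < 16 -> q <= (1 - / (c * e) / 16) ^ 16 -> 1 < 2 * q ^ d + q ->
      1 < 2 * (j / k) ^ d + j / k).
    { intros c e q Hc He Hq Hw Hce Hq1 Hq2.
      assert (0 < / (c * e)) by (apply Rinv_0_lt_compat; nra).
      assert (q < j / k).
      { apply Rle_lt_trans with (1 := Hq1).
        apply Rle_lt_trans with (exp (- / (c * e))).
        - pose proof (exp_neg_lower (/ (c * e)) 16) as H0.
          rewrite (INR_IZR_INZ 16) in H0. apply H0. simpl. lra.
        - apply zeros_ratio; trivial. intros w Hw0. specialize (Hw w Hw0). lra. }
      pose proof (pow_incr q (j / k) d ltac:(lra)). lra. }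
    destruct Ed as [Ed|[Ed|Ed]]; rewrite (f_equal INR Ed) in Hn; clear J1 J2;
      rewrite (INR_IZR_INZ) in Hn; simpl IZR in Hn.
    (* For d = 4 the difference of the quadratics is exactly (w - 2)^2 / 5, a tangency at w = 2; the
       pairs for d = 5 and 6 leave a positive margin. *)
    + apply (Hn (4 / 5) 3 (65 / 100)); rewrite ?Ed; try lra.
      intros w _. pose proof (pow2_ge_0 (w - 2)). nra.
    + apply (Hn (85 / 100) (33 / 10) (69 / 100)); rewrite ?Ed; try lra.
      intros w _. pose proof (pow2_ge_0 (w - 2)). nra.
    + apply (Hn (9 / 10) (35 / 10) (722 / 1000)); rewrite ?Ed; try lra.
      intros w _. pose proof (pow2_ge_0 (w - 1)). nra.
Qed.

End FirstZeros.

(** * Sign of F on the cells of the two partitions *)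

Definition bU (d : nat) (r : R) : R := bA d (-1) r * bA d 1 r.

Lemma is_derive_bS (d : nat) (r : R) :
  (4 <= d)%nat -> 0 < r -> is_derive (bS d) r ((4 * bU d r - INR d * bS d r) / r).
Proof.
  intros Hd Hr. assert (r <> 0) by lra. eapply is_derive_value.
  - apply (is_derive_Rplus (fun r => bB d (-1) r * bA d 1 r)
             (fun r => bB d 1 r * bA d (-1) r)).
    + apply (is_derive_Rmult (bB d (-1)) (bA d 1));
        [now apply is_derive_bB | now apply is_derive_bA].
    + apply (is_derive_Rmult (bB d 1) (bA d (-1)));
        [now apply is_derive_bB | now apply is_derive_bA].
  - unfold bU, bS. field. easy.
Qed.

Lemma is_derive_bU (d : nat) (r : R) :
  (4 <= d)%nat -> bA d (-1) r <> 0 ->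
  is_derive (bU d) r (- bU d r * (bP d r - bQ d r)).
Proof.
  intros Hd HA. pose proof (bA_plus_pos d r Hd). eapply is_derive_value.
  - apply (is_derive_Rmult (bA d (-1)) (bA d 1)); now apply is_derive_bA.
  - unfold bU, bP, bQ, bW. field. lra.
Qed.

Lemma continuous_bU (d : nat) (r : R) : (4 <= d)%nat -> continuous (bU d) r.
Proof.
  intros Hd. apply (continuous_mult (bA d (-1)) (bA d 1)); now apply continuous_bA.
Qed.

(** Needed at r = 0, the outer radius for a = 1, which [is_derive_bf] does not reach. *)
Lemma continuous_bf (d : nat) (r : R) :
  (4 <= d)%nat -> bA d (-1) r <> 0 -> continuous (bf d) r.
Proof.
  intros Hd HA.
  assert (Hh : continuous (fun r : R => r / 2) r)
    by (apply (ex_derive_continuous (fun r : R => r / 2)); auto_derive; easy).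
  apply (continuous_mult (fun r => r ^ (d - 1)) (fun r => bP d r + bQ d r));
    [apply continuous_pow_fun|].
  apply (continuous_plus (bP d) (bQ d)).
  - apply (continuous_mult (fun r => r / 2) (bW d (-1))); [easy | now apply continuous_bW].
  - apply (continuous_mult (fun r => r / 2) (bW d 1)); [easy|]. apply continuous_bW; [easy|].
    pose proof (bA_plus_pos d r Hd). lra.
Qed.

(* Equivalent to f(r) >= (2/d) r^d, the bound obtained by integrating f' >= 2 r^(d-1). *)
Lemma bS_lower (d : nat) (j k r : R) :
  (4 <= d)%nat -> first_pos_zero (BesselJ (nu_of d)) j -> first_pos_zero (f_nu d) k ->
  0 < r < j -> 4 * bU d r <= INR d * bS d r.
Proof.
  intros Hd Hj Hk Hr.
  (* In the derivative the r^(d-1) terms cancel and 4 r^d U (p - q) remains, nonnegative because p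
     >= q before [j]. *)
  assert (H : 0 ^ d * (INR d * bS d 0 - 4 * bU d 0) <= r ^ d * (INR d * bS d r - 4 * bU d r)).
  { apply (nondecreasing_of_derive (fun r => r ^ d * (INR d * bS d r - 4 * bU d r))
      (fun r => r ^ d * (4 * (bU d r * (bP d r - bQ d r))))); [lra | | |].
    - intros x _.
      apply (continuous_mult (fun r => r ^ d) (fun r => INR d * bS d r - 4 * bU d r));
        [apply continuous_pow_fun|].
      apply (continuous_minus (fun r => INR d * bS d r) (fun r => 4 * bU d r)).
      + apply (continuous_scal_r (INR d) (bS d)). now apply continuous_bS.
      + apply (continuous_scal_r 4 (bU d)). now apply continuous_bU.
    - intros x Hx. pose proof (bA_minus_pos d j x Hd Hj ltac:(lra)) as HA.
      eapply is_derive_value.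
      + apply (is_derive_Rmult (fun r => r ^ d) (fun r => INR d * bS d r - 4 * bU d r)).
        { apply (is_derive_Rpow (fun r => r)); [lra | apply is_derive_Rid]. }
        apply (is_derive_Rminus (fun r => INR d * bS d r) (fun r => 4 * bU d r)).
        * apply (is_derive_Rmult (fun _ => INR d) (bS d)); [apply is_derive_Rcst|].
          apply is_derive_bS; [easy | lra].
        * apply (is_derive_Rmult (fun _ => 4) (bU d)); [apply is_derive_Rcst|].
          apply is_derive_bU; [easy | lra].
      + field. lra.
    - intros x Hx. pose proof (bA_minus_pos d j x Hd Hj ltac:(lra)).
      pose proof (bA_plus_pos d x Hd).
      destruct (bP_minus_bQ_monotone d j k Hd Hj Hk x x ltac:(lra) ltac:(lra)) as [HPQ _].
      pose proof (pow_lt x d ltac:(lra)).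
      assert (0 < bU d x) by (apply Rmult_lt_0_compat; easy).
      apply Rmult_le_pos; [lra|]. apply Rmult_le_pos; [lra|]. apply Rmult_le_pos; lra. }
  rewrite (pow_i d) in H by lia. pose proof (pow_lt r d ltac:(lra)). nra.
Qed.

Section Regions.

Variables (d : nat) (j k aI aS : R).
Hypothesis Hd : (4 <= d)%nat.
Hypothesis Hj : first_pos_zero (BesselJ (nu_of d)) j.
Hypothesis Hk : first_pos_zero (f_nu d) k.
Hypothesis HaI : 0 <= aI <= 1.
Hypothesis EaI : b_of d aI = j / k.
Hypothesis HaS : 0 <= aS <= 1.
Hypothesis EaS : aS * K_of d aS = j / k.

Lemma ratio_bounds : 0 < j / k < 1.
Proof.
  pose proof (j_pos d j Hj). pose proof (j_lt_k d j k Hd Hj Hk).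
  split; [apply Rdiv_lt_0_compat; lra|]. apply Rlt_div_l; lra.
Qed.

Lemma k_pos : 0 < k.
Proof. apply Hk. Qed.

Lemma scale_ratio : k * (j / k) = j.
Proof. pose proof k_pos. field. lra. Qed.

Lemma aI_lt1 : aI < 1.
Proof.
  destruct HaI as [_ [H|H]]; [easy|]. pose proof ratio_bounds.
  rewrite <- EaI, H, b_of_1 in H0. lra.
Qed.

(** With b = j/k, clearing the denominator turns the claim into 1 - b^d < b + b^d. *)
Lemma aI_aK_lt : aI * K_of d aI < j / k.
Proof.
  rewrite aK_eq by easy. rewrite EaI. pose proof ratio_bounds.
  pose proof (zeros_ratio_bound d j k Hd Hj Hk) as H0.
  pose proof (pow_lt (j / k) (d - 1) ltac:(lra)).
  apply Rlt_div_l; [lra|]. rewrite (pow_split (j / k) d Hd) in *. lra.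
Qed.

Lemma aI_lt_aS : aI < aS.
Proof.
  apply Rnot_le_lt. intros H. pose proof aI_aK_lt.
  destruct H as [H|H].
  - pose proof (aK_strict_increasing d aS aI Hd ltac:(lra) ltac:(lra)). lra.
  - subst aS. lra.
Qed.

(** This and the next three lemmas place the inner radius k a K(a) and the outer radius k b(a)
    relative to [j]: inner below and outer above before [aI], the reverse after [aS]. That fixes the
    sign of each term of F. *)
Lemma inner_below (a : R) : 0 < a <= aI -> 0 < k * K_of d a * a < j.
Proof.
  intros Ha. pose proof k_pos. pose proof (K_of_pos d a ltac:(lra)).
  assert (H1 : a * K_of d a <= aI * K_of d aI).
  { destruct Ha as [Ha [H1|H1]]; [|subst a; lra].
    left. apply aK_strict_increasing; [easy | lra | lra]. }
  pose proof aI_aK_lt. split.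
  - apply Rmult_lt_0_compat; [apply Rmult_lt_0_compat|]; lra.
  - rewrite <- scale_ratio. rewrite Rmult_assoc. apply Rmult_lt_compat_l; lra.
Qed.

Lemma inner_above (a : R) : aS < a <= 1 -> j < k * K_of d a * a <= k.
Proof.
  intros Ha. pose proof k_pos.
  pose proof (aK_strict_increasing d aS a Hd ltac:(lra) ltac:(lra)).
  pose proof (K_of_pos d a ltac:(lra)). pose proof (K_of_le1 d a Hd ltac:(lra)).
  rewrite <- scale_ratio at 1. rewrite Rmult_assoc. split.
  - apply Rmult_lt_compat_l; lra.
  - assert (K_of d a * a <= 1) by nra. nra.
Qed.

Lemma outer_above (a : R) : 0 <= a < aI -> j < k * b_of d a <= k.
Proof.
  intros Ha. pose proof k_pos.
  pose proof (b_of_strict_decreasing d a aI Hd ltac:(lra) ltac:(lra)).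
  pose proof (b_of_le1 d a Hd ltac:(lra)).
  rewrite <- scale_ratio at 1. split; [apply Rmult_lt_compat_l; lra | nra].
Qed.

Lemma outer_below (a : R) : aS <= a < 1 -> 0 < k * b_of d a < j.
Proof.
  intros Ha. pose proof k_pos. pose proof aI_lt_aS.
  pose proof (b_of_strict_decreasing d aI a Hd ltac:(lra) ltac:(lra)).
  pose proof (b_of_pos d a Hd ltac:(lra)).
  rewrite <- scale_ratio. split; [nra|]. apply Rmult_lt_compat_l; lra.
Qed.

Lemma F_nu_eq (a : R) :
  0 <= a <= 1 -> F_nu d k a = bf d (k * K_of d a * a) + K_of d a ^ d * bf d (k * b_of d a).
Proof.
  intros Ha. pose proof k_pos. unfold F_nu.
  destruct (K_of_increasing d a a Hd ltac:(lra) ltac:(lra)) as [HK _].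
  rewrite !f_nu_bf; trivial.
  - apply Rmult_le_pos; [lra | apply b_of_ge0].
  - apply Rmult_le_pos; [apply Rmult_le_pos|]; lra.
Qed.

Lemma bf_0 : bf d 0 = 0.
Proof. unfold bf. rewrite pow_i by lia. ring. Qed.

Lemma F_nu_0 : F_nu d k 0 = 0.
Proof.
  rewrite F_nu_eq by lra. rewrite K_of_0, Rmult_0_r, bf_0 by easy.
  rewrite pow_i by lia. ring.
Qed.

Lemma F_nu_1 : F_nu d k 1 = 0.
Proof.
  rewrite F_nu_eq by lra. rewrite K_of_1, b_of_1 by easy.
  rewrite !Rmult_1_r, Rmult_0_r, bf_0, (bf_k d k Hd Hk). ring.
Qed.

(** The inner term increases with a and is bounded by its value at y. The outer f is nonpositive and
    decreases with a while its weight K^d grows, so the outer term is bounded by its value at x. *)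
Lemma F_nu_le_lower_cell (x y a : R) :
  0 < x <= a -> a < y <= aI ->
  f_nu d (k * K_of d y * y) + K_of d x ^ d * f_nu d (k * b_of d x) <= 0 ->
  F_nu d k a <= 0.
Proof.
  intros Hx Hy H. pose proof aI_lt1. pose proof k_pos as Hk0.
  rewrite F_nu_eq by lra.
  destruct (inner_below a ltac:(lra)). destruct (inner_below y ltac:(lra)).
  destruct (outer_above a ltac:(lra)). destruct (outer_above x ltac:(lra)).
  pose proof (j_pos d j Hj).
  rewrite !f_nu_bf in H by (easy || lra).
  pose proof (K_of_increasing d a y Hd ltac:(lra) ltac:(lra)).
  pose proof (K_of_increasing d x a Hd ltac:(lra) ltac:(lra)).
  pose proof (b_of_decreasing d x a Hd ltac:(lra) ltac:(lra)).
  assert (bf d (k * K_of d a * a) <= bf d (k * K_of d y * y)).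
  { apply (bf_monotone_below d j k Hd Hj Hk); [|easy]. split; [easy|].
    apply Rmult_le_compat; try nra. }
  assert (bf d (k * b_of d a) <= bf d (k * b_of d x)).
  { apply (bf_monotone_above d j k Hd Hj Hk); [|easy]. split; [easy|]. nra. }
  pose proof (bf_le0 d j k Hd Hj Hk (k * b_of d a) ltac:(lra)).
  pose proof (pow_incr (K_of d x) (K_of d a) d ltac:(lra)).
  pose proof (pow_le (K_of d x) d ltac:(lra)).
  nra.
Qed.

(** Now the outer f is positive, so its weight K^d is bounded by 1; this is why the condition on
    these cells carries no factor K^d. *)
Lemma F_nu_le_upper_cell (x y a : R) :
  aS <= x <= a -> aS < a < y -> y <= 1 ->
  f_nu d (k * K_of d y * y) + f_nu d (k * b_of d x) <= 0 ->
  F_nu d k a <= 0.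
Proof.
  intros Hx Ha Hy H. pose proof k_pos as Hk0.
  rewrite F_nu_eq by lra.
  destruct (inner_above a ltac:(lra)). destruct (inner_above y ltac:(lra)).
  destruct (outer_below a ltac:(lra)). destruct (outer_below x ltac:(lra)).
  pose proof (j_pos d j Hj).
  rewrite !f_nu_bf in H by (easy || lra).
  pose proof (K_of_increasing d a y Hd ltac:(lra) ltac:(lra)).
  pose proof (K_of_le1 d a Hd ltac:(lra)).
  pose proof (b_of_decreasing d x a Hd ltac:(lra) ltac:(lra)).
  assert (bf d (k * K_of d a * a) <= bf d (k * K_of d y * y)).
  { apply (bf_monotone_above d j k Hd Hj Hk); [|easy]. split; [easy|].
    apply Rmult_le_compat; try nra. }
  assert (bf d (k * b_of d a) <= bf d (k * b_of d x)).
  { apply (bf_monotone_below d j k Hd Hj Hk); [|easy]. split; [easy|]. nra. }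
  pose proof (bf_pos d j (k * b_of d a) Hd Hj ltac:(lra)).
  pose proof (pow_incr (K_of d a) 1 d ltac:(lra)) as Hp. rewrite pow1 in Hp.
  nra.
Qed.

(** On (0,aI) this is G1 + G2 with both taken at the same a, the coefficient produced by
    differentiating [bY]; the hypothesis takes them at the two ends of the first cell. *)
Definition G12 (a : R) : R :=
  (1 + kappa d a) * (bP d (k * K_of d a * a) - bQ d (k * K_of d a * a))
    / (1 + b_of d a ^ (d - 1)) + k ^ (d - 1) * bg d (k * b_of d a).

Lemma G12_le (x a : R) : 0 < a < x -> x <= aI -> G12 a <= G1 d k x + G2 d k 0.
Proof.
  intros Ha Hx. pose proof aI_lt1. pose proof k_pos as Hk0. pose proof (j_lt_k d j k Hd Hj Hk).
  pose proof (j_pos d j Hj).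
  rewrite G1_eq by (easy || lra). unfold G2. rewrite b_of_0, Rmult_1_r, g_nu_bg by (easy || lra).
  unfold G12. apply Rplus_le_compat.
  - destruct (inner_below a ltac:(lra)). destruct (inner_below x ltac:(lra)).
    pose proof (K_of_increasing d a x Hd ltac:(lra) ltac:(lra)).
    pose proof (kappa_ge0 d a Hd ltac:(lra)).
    pose proof (kappa_increasing d a x Hd ltac:(lra) ltac:(lra)).
    destruct (bP_minus_bQ_monotone d j k Hd Hj Hk (k * K_of d a * a) (k * K_of d x * x)).
    { split; [easy|]. apply Rmult_le_compat; try nra. }
    { easy. }
    pose proof (K_of_denom_pos d a). pose proof (K_of_denom_pos d x).
    apply Rmult_le_compat.
    + apply Rmult_le_pos; lra.
    + left. now apply Rinv_0_lt_compat.
    + apply Rmult_le_compat; lra.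
    + apply Rinv_le_contravar; [easy|]. apply Rplus_le_compat_l, pow_incr.
      split; [apply b_of_ge0 | apply b_of_decreasing; [easy | lra | lra]].
  - apply Rmult_le_compat_l; [apply pow_le; lra|].
    destruct (outer_above a ltac:(lra)).
    apply (bg_monotone_above d j k Hd Hj Hk); lra.
Qed.

(* F(a)/K(a)^d multiplied by the integrating factor U = exp (- int (p - q)) at r = k K(a) a;
   this turns the differential inequality for F/K^d into monotonicity. *)
Definition bY (a : R) : R :=
  (k * a) ^ d * bS d (k * K_of d a * a) / 2 + bU d (k * K_of d a * a) * bf d (k * b_of d a).

(** Since [bY] involves no division by K or U, it continues F U / K^d to a = 0. *)
Lemma F_nu_bY (a : R) :
  0 < a < aI -> F_nu d k a * bU d (k * K_of d a * a) = K_of d a ^ d * bY a.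
Proof.
  intros Ha. pose proof aI_lt1. rewrite F_nu_eq by lra.
  destruct (inner_below a ltac:(lra)) as [Hr Hrj].
  pose proof (bA_minus_pos d j _ Hd Hj (conj (Rlt_le _ _ Hr) Hrj)) as HA.
  pose proof (bA_plus_pos d (k * K_of d a * a) Hd) as HA'.
  unfold bY. unfold bf at 1. rewrite bP_plus_bQ by (easy || lra). fold (bU d (k * K_of d a * a)).
  assert (HU : 0 < bU d (k * K_of d a * a)) by now apply Rmult_lt_0_compat.
  assert (E : (k * K_of d a * a) ^ (d - 1) * (k * K_of d a * a) = K_of d a ^ d * (k * a) ^ d).
  { rewrite <- Rpow_mult_distr, Rmult_comm, <- pow_split by easy. f_equal. ring. }
  transitivity ((k * K_of d a * a) ^ (d - 1) * (k * K_of d a * a) * bS d (k * K_of d a * a) / 2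
    + K_of d a ^ d * (bU d (k * K_of d a * a) * bf d (k * b_of d a))).
  - field. lra.
  - rewrite E. field.
Qed.

(** From b^(d-1) b' = - a^(d-1), the constant 2 in f' at the outer radius contributes - 2 U k^d
    a^(d-1), which cancels the part of the S term free of [kappa]. Of the two products left, one is
    governed by [bS_lower], the other by the sign of [G12]. *)
Lemma is_derive_bY (a : R) :
  0 < a < aI ->
  is_derive bY a
    (- (k ^ d * a ^ (d - 1) * kappa d a
        * (INR d * bS d (k * K_of d a * a) - 4 * bU d (k * K_of d a * a)) / 2)
     - bf d (k * b_of d a) * bU d (k * K_of d a * a) * (k * a ^ (d - 1) * G12 a)).
Proof.
  intros Ha. pose proof aI_lt1. pose proof k_pos as Hk0. pose proof (j_pos d j Hj) as Hj0.
  destruct (inner_below a ltac:(lra)) as [Hr Hrj].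
  destruct (outer_above a ltac:(lra)) as [Hb1 Hb2].
  pose proof (bA_minus_pos d j _ Hd Hj (conj (Rlt_le _ _ Hr) Hrj)) as HA.
  pose proof (bA_minus_neg d j k Hd Hj Hk (k * b_of d a) ltac:(lra)) as HAb.
  pose proof (is_derive_scaled_aK d k a Hd ltac:(lra)) as Dr.
  pose proof (is_derive_scaled_b d k a Hd ltac:(lra)) as Db.
  eapply is_derive_value.
  - apply (is_derive_Rplus (fun a => (k * a) ^ d * bS d (k * K_of d a * a) / 2)
      (fun a => bU d (k * K_of d a * a) * bf d (k * b_of d a))).
    + apply (is_derive_Rdiv (fun a => (k * a) ^ d * bS d (k * K_of d a * a)) (fun _ => 2));
        [lra | | apply is_derive_Rcst].
      apply (is_derive_Rmult (fun a => (k * a) ^ d) (fun a => bS d (k * K_of d a * a))).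
      * apply (is_derive_Rpow (fun a => k * a)); [apply Rgt_not_eq; nra|].
        apply (is_derive_Rmult (fun _ => k) (fun a => a)); [apply is_derive_Rcst |
          apply is_derive_Rid].
      * apply (is_derive_Rcomp (bS d) (fun a => k * K_of d a * a)); [|exact Dr].
        now apply is_derive_bS.
    + apply (is_derive_Rmult (fun a => bU d (k * K_of d a * a)) (fun a => bf d (k * b_of d a))).
      * apply (is_derive_Rcomp (bU d) (fun a => k * K_of d a * a)); [|exact Dr].
        apply is_derive_bU; [easy | lra].
      * apply (is_derive_Rcomp (bf d) (fun a => k * b_of d a)); [|exact Db].
        apply is_derive_bf; [easy | lra | lra].
  - unfold G12.
    pose proof (bf_mul_bg d (k * b_of d a) ltac:(lra)) as Efg.
    replace (2 + bP d (k * b_of d a) ^ 2 - bQ d (k * b_of d a) ^ 2)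
      with (2 + bf d (k * b_of d a) * bg d (k * b_of d a)) by (rewrite Efg; ring).
    clear Efg Dr Db.
    set (S := bS d _). set (U := bU d _). set (f := bf d _). set (g := bg d _).
    set (p := bP d _). set (q := bQ d _). set (kp := kappa d a).
    rewrite !Rpow_mult_distr, !(pow_split k d Hd), (pow_split a d Hd).
    pose proof (K_of_denom_pos d a) as Hden.
    pose proof (b_of_pos d a Hd ltac:(lra)) as Hb.
    pose proof (pow_lt (b_of d a) (d - 1) Hb) as Hbp.
    pose proof (pow_lt a (d - 1) ltac:(lra)) as Hap.
    clearbody S U f g p q kp. unfold K_of.
    generalize dependent (b_of d a ^ (d - 1)). intros be Hden Hbe.
    generalize dependent (a ^ (d - 1)). intros T HT.
    generalize (k ^ (d - 1)). intros kd.
    field. repeat split; lra.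
Qed.

Lemma bY_le0 (x a : R) :
  0 < a < x -> x <= aI -> G1 d k x + G2 d k 0 <= 0 -> bY a <= 0.
Proof.
  intros Ha Hx HG. pose proof aI_lt1. pose proof k_pos as Hk0.
  pose proof (j_pos d j Hj) as Hj0. pose proof (j_lt_k d j k Hd Hj Hk) as Hjk.
  (* Here f(k) = 0 enters: b(0) = 1 puts the outer radius at [k]. *)
  assert (E0 : bY 0 = 0).
  { unfold bY. rewrite b_of_0, !Rmult_0_r, pow_i by (easy || lia).
    rewrite Rmult_1_r, (bf_k d k Hd Hk). field. }
  assert (H0 : - bY 0 <= - bY a); [|lra].
  apply (nondecreasing_of_derive (fun a => - bY a) (fun a =>
    - (- (k ^ d * a ^ (d - 1) * kappa d a
        * (INR d * bS d (k * K_of d a * a) - 4 * bU d (k * K_of d a * a)) / 2)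
     - bf d (k * b_of d a) * bU d (k * K_of d a * a) * (k * a ^ (d - 1) * G12 a))));
    [lra | | |].
  - intros t Ht. destruct (outer_above t ltac:(lra)) as [Hb1 Hb2].
    pose proof (bA_minus_neg d j k Hd Hj Hk (k * b_of d t) ltac:(lra)) as HAb.
    apply (continuous_opp bY).
    apply (continuous_plus (fun a => (k * a) ^ d * bS d (k * K_of d a * a) / 2)
      (fun a => bU d (k * K_of d a * a) * bf d (k * b_of d a))).
    + apply (continuous_mult (fun a => (k * a) ^ d * bS d (k * K_of d a * a)) (fun _ => / 2));
        [|apply continuous_const].
      apply (continuous_mult (fun a => (k * a) ^ d) (fun a => bS d (k * K_of d a * a))).
      * apply (continuous_comp (fun a => k * a) (fun t => t ^ d)); [|apply continuous_pow_fun].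
        apply (ex_derive_continuous (fun a : R => k * a)). auto_derive; easy.
      * apply (continuous_comp (fun a => k * K_of d a * a) (bS d));
          [now apply continuous_scaled_aK | now apply continuous_bS].
    + apply (continuous_mult (fun a => bU d (k * K_of d a * a)) (fun a => bf d (k * b_of d a))).
      * apply (continuous_comp (fun a => k * K_of d a * a) (bU d));
          [now apply continuous_scaled_aK | now apply continuous_bU].
      * apply (continuous_comp (fun a => k * b_of d a) (bf d));
          [now apply continuous_scaled_b | apply continuous_bf; [easy | lra]].
  - intros t Ht. apply is_derive_Ropp. apply is_derive_bY. lra.
  - intros t Ht. destruct (inner_below t ltac:(lra)) as [Hr Hrj].
    destruct (outer_above t ltac:(lra)) as [Hb1 Hb2].
    pose proof (bA_minus_pos d j _ Hd Hj (conj (Rlt_le _ _ Hr) Hrj)) as HA.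
    pose proof (bA_plus_pos d (k * K_of d t * t) Hd) as HA'.
    pose proof (bS_lower d j k (k * K_of d t * t) Hd Hj Hk ltac:(lra)) as HS.
    pose proof (bf_le0 d j k Hd Hj Hk (k * b_of d t) ltac:(lra)) as Hf.
    pose proof (G12_le x t ltac:(lra) Hx) as HG12.
    pose proof (kappa_ge0 d t Hd ltac:(lra)) as Hkp.
    assert (HU : 0 < bU d (k * K_of d t * t)) by now apply Rmult_lt_0_compat.
    pose proof (pow_lt k d Hk0) as Hkd. pose proof (pow_lt t (d - 1) ltac:(lra)) as Htd.
    assert (T1' : 0 <= k ^ d * t ^ (d - 1) * kappa d t
        * (INR d * bS d (k * K_of d t * t) - 4 * bU d (k * K_of d t * t))).
    { apply Rmult_le_pos; [|lra]. apply Rmult_le_pos; [|lra].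
      apply Rmult_le_pos; lra. }
    assert (T2' : 0 <= (- bf d (k * b_of d t)) * bU d (k * K_of d t * t)
        * (k * t ^ (d - 1) * - G12 t)).
    { apply Rmult_le_pos; [apply Rmult_le_pos; lra|].
      apply Rmult_le_pos; [apply Rmult_le_pos|]; lra. }
    lra.
Qed.

Lemma F_nu_le_first_cell (x a : R) :
  0 < a < x -> x <= aI -> G1 d k x + G2 d k 0 <= 0 -> F_nu d k a <= 0.
Proof.
  intros Ha Hx HG. pose proof (bY_le0 x a Ha Hx HG) as HY.
  destruct (inner_below a ltac:(lra)) as [Hr Hrj].
  pose proof (bA_minus_pos d j _ Hd Hj (conj (Rlt_le _ _ Hr) Hrj)) as HA.
  pose proof (bA_plus_pos d (k * K_of d a * a) Hd) as HA'.
  assert (HU : 0 < bU d (k * K_of d a * a)) by now apply Rmult_lt_0_compat.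
  pose proof (F_nu_bY a ltac:(lra)) as E.
  pose proof (pow_lt _ d (K_of_pos d a ltac:(lra))). nra.
Qed.

(** Both radii yield the common factor k^d K^d a^(d-1), so the bracket leaves 2 [kappa] against p^2
    - q^2 at the outer radius. *)
Definition dF (a : R) : R :=
  k ^ d * K_of d a ^ d * a ^ (d - 1)
    * ((1 + kappa d a) * (2 + (bP d (k * K_of d a * a) ^ 2 - bQ d (k * K_of d a * a) ^ 2))
       - 2 - (bP d (k * b_of d a) ^ 2 - bQ d (k * b_of d a) ^ 2))
  + INR d * K_of d a ^ d * kappa d a / a * bf d (k * b_of d a).

Lemma is_derive_F (a : R) :
  aS < a < 1 ->
  is_derive (fun a => bf d (k * K_of d a * a) + K_of d a ^ d * bf d (k * b_of d a)) a (dF a).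
Proof.
  intros Ha. pose proof k_pos as Hk0. pose proof (j_pos d j Hj) as Hj0.
  destruct (inner_above a ltac:(lra)) as [Hr1 Hr2].
  destruct (outer_below a ltac:(lra)) as [Hb1 Hb2].
  pose proof (K_of_pos d a ltac:(lra)) as HK.
  pose proof (bA_minus_neg d j k Hd Hj Hk (k * K_of d a * a) ltac:(lra)) as HA.
  pose proof (bA_minus_pos d j (k * b_of d a) Hd Hj ltac:(lra)) as HAb.
  pose proof (is_derive_scaled_aK d k a Hd ltac:(lra)) as Dr.
  pose proof (is_derive_scaled_b d k a Hd ltac:(lra)) as Db.
  pose proof (is_derive_K_of d a Hd ltac:(lra)) as DK.
  eapply is_derive_value.
  - apply (is_derive_Rplus (fun a => bf d (k * K_of d a * a))
             (fun a => K_of d a ^ d * bf d (k * b_of d a))).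
    + apply (is_derive_Rcomp (bf d) (fun a => k * K_of d a * a)); [|exact Dr].
      apply is_derive_bf; [easy | lra | lra].
    + apply (is_derive_Rmult (fun a => K_of d a ^ d) (fun a => bf d (k * b_of d a))).
      * apply (is_derive_Rpow (K_of d)); [lra | exact DK].
      * apply (is_derive_Rcomp (bf d) (fun a => k * b_of d a)); [|exact Db].
        apply is_derive_bf; [easy | lra | lra].
  - unfold dF. clear Dr Db DK.
    set (f := bf d _). set (p := bP d (k * K_of d a * a)). set (q := bQ d (k * K_of d a * a)).
    set (p' := bP d (k * b_of d a)). set (q' := bQ d (k * b_of d a)). set (kp := kappa d a).
    rewrite !Rpow_mult_distr, !(pow_split k d Hd), !(pow_split (K_of d a) d Hd).
    pose proof (b_of_pos d a Hd ltac:(lra)) as Hb.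
    pose proof (pow_lt (b_of d a) (d - 1) Hb) as Hbp.
    clearbody f p q p' q' kp.
    field. repeat split; lra.
Qed.

(** F(1) = 0, so F nondecreasing on [a,1] suffices. The condition at y persists to the right since
    [kappa] increases and p^2 - q^2 decreases as the outer radius shrinks; the other terms of [dF]
    are nonnegative. *)
Lemma F_nu_le_last_cell (y a : R) :
  aS <= y <= a -> aS < a < 1 ->
  bP d (k * b_of d y) ^ 2 - bQ d (k * b_of d y) ^ 2 <= 2 * kappa d y ->
  F_nu d k a <= 0.
Proof.
  intros Hy Ha HPQ. pose proof k_pos as Hk0. pose proof (j_pos d j Hj) as Hj0.
  pose proof (j_lt_k d j k Hd Hj Hk) as Hjk.
  rewrite <- F_nu_1. rewrite !F_nu_eq by lra.
  apply (nondecreasing_of_derive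
    (fun a => bf d (k * K_of d a * a) + K_of d a ^ d * bf d (k * b_of d a)) dF); [lra | | |].
  - intros t Ht. destruct (inner_above t ltac:(lra)) as [Hr1 Hr2].
    pose proof (bA_minus_neg d j k Hd Hj Hk (k * K_of d t * t) ltac:(lra)) as HA.
    apply (continuous_plus (fun a => bf d (k * K_of d a * a))
             (fun a => K_of d a ^ d * bf d (k * b_of d a))).
    + apply (continuous_comp (fun a => k * K_of d a * a) (bf d));
        [now apply continuous_scaled_aK | apply continuous_bf; [easy | lra]].
    + apply (continuous_mult (fun a => K_of d a ^ d) (fun a => bf d (k * b_of d a))).
      * apply (continuous_comp (K_of d) (fun t => t ^ d));
          [now apply continuous_K_of | apply continuous_pow_fun].
      * apply (continuous_comp (fun a => k * b_of d a) (bf d)); [now apply continuous_scaled_b|].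
        apply continuous_bf; [easy|].
        assert (0 <= k * b_of d t < j).
        { destruct (Rle_lt_or_eq_dec t 1 ltac:(lra)) as [Ht1|Ht1].
          - destruct (outer_below t ltac:(lra)). lra.
          - subst t. rewrite b_of_1. lra. }
        pose proof (bA_minus_pos d j (k * b_of d t) Hd Hj ltac:(lra)). lra.
  - intros t Ht. apply is_derive_F. lra.
  - intros t Ht. pose proof aI_lt_aS.
    destruct (inner_above t ltac:(lra)) as [Hr1 Hr2].
    destruct (outer_below t ltac:(lra)) as [Hb1 Hb2].
    destruct (outer_below y ltac:(lra)) as [Hc1 Hc2].
    pose proof (b_of_decreasing d y t Hd ltac:(lra) ltac:(lra)).
    pose proof (bP2_minus_bQ2_monotone d j k Hd Hj Hk (k * b_of d t) (k * b_of d y)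
      ltac:(split; nra) Hc2) as [_ HM].
    pose proof (bP2_minus_bQ2_ge0_above d j k Hd Hj Hk (k * K_of d t * t) ltac:(lra)) as HN.
    pose proof (bf_pos d j (k * b_of d t) Hd Hj ltac:(lra)) as Hf.
    pose proof (kappa_ge0 d t Hd ltac:(lra)) as Hkp.
    pose proof (kappa_increasing d y t Hd ltac:(lra) ltac:(lra)) as Hkm.
    pose proof (pow_lt _ d (K_of_pos d t ltac:(lra))) as HKd.
    pose proof (pow_lt k d Hk0) as Hkd. pose proof (pow_lt t (d - 1) ltac:(lra)) as Htd.
    pose proof (INR_ge4 d Hd). unfold dF. apply Rplus_le_le_0_compat.
    + apply Rmult_le_pos; [apply Rmult_le_pos; [apply Rmult_le_pos|]; lra|]. nra.
    + apply Rmult_le_pos; [|lra]. apply Rmult_le_pos.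
      * apply Rmult_le_pos; [apply Rmult_le_pos|]; lra.
      * left. apply Rinv_0_lt_compat. lra.
Qed.

(** [T1] is [kappa] times (a K)^d / a, and this factor is at most 1 because a K <= a <= 1. *)
Lemma T1_le_kappa (a : R) : 0 < a < 1 -> T1 d a <= kappa d a.
Proof.
  intros Ha. unfold T1. rewrite K'_of_eq by easy.
  pose proof (K_of_pos d a ltac:(lra)) as HK. pose proof (K_of_le1 d a Hd ltac:(lra)).
  pose proof (kappa_ge0 d a Hd ltac:(lra)).
  replace ((a * K_of d a) ^ d * (K_of d a * kappa d a / a) / K_of d a)
    with ((a * K_of d a) ^ d / a * kappa d a) by (field; lra).
  assert ((a * K_of d a) ^ d / a <= 1).
  { apply Rle_div_l; [lra|]. rewrite (pow_split _ d Hd).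
    assert (0 <= a * K_of d a <= 1) by nra.
    pose proof (pow_incr (a * K_of d a) 1 (d - 1) ltac:(lra)) as Hp. rewrite pow1 in Hp.
    pose proof (pow_le (a * K_of d a) (d - 1) ltac:(lra)).
    assert (a * K_of d a <= a) by nra. nra. }
  nra.
Qed.

Lemma last_condition (y : R) :
  aS <= y < 1 ->
  2 * T1 d y
  - f_nu d (k * b_of d y) * Rabs (g_nu d (k * K_of d y * y))
    * ((INR d - 1) / y ^ d * (1 + / b_of d y) + 1)
  - f_nu d (k * b_of d y) * g_nu d (k * b_of d y) >= 0 ->
  bP d (k * b_of d y) ^ 2 - bQ d (k * b_of d y) ^ 2 <= 2 * kappa d y.
Proof.
  intros Hy H. pose proof aI_lt_aS. destruct (outer_below y Hy) as [Hb1 Hb2].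
  pose proof (T1_le_kappa y ltac:(lra)).
  rewrite (f_nu_bf d (k * b_of d y)), (g_nu_bg d (k * b_of d y)) in H by (easy || lra).
  rewrite bf_mul_bg in H by easy.
  pose proof (bf_pos d j (k * b_of d y) Hd Hj ltac:(lra)).
  pose proof (b_of_pos d y Hd ltac:(lra)) as Hb. apply Rinv_0_lt_compat in Hb.
  pose proof (INR_ge4 d Hd).
  (* The subtracted product is nonnegative because f is positive at the outer radius, so the
     assumption yields 2 T1 >= p^2 - q^2 there. *)
  assert (0 <= bf d (k * b_of d y) * Rabs (g_nu d (k * K_of d y * y))
    * ((INR d - 1) / y ^ d * (1 + / b_of d y) + 1)).
  { apply Rmult_le_pos; [apply Rmult_le_pos; [lra | apply Rabs_pos]|].
    assert (0 < (INR d - 1) / y ^ d) by (apply Rdiv_lt_0_compat; [|apply pow_lt]; lra).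
    nra. }
  lra.
Qed.

End Regions.

Theorem theorem6 (d : nat) (jnu knu aI aS : R) :
  (4 <= d)%nat ->
  first_pos_zero (BesselJ (nu_of d)) jnu ->
  first_pos_zero (f_nu d) knu ->
  0 <= aI <= 1 -> b_of d aI = jnu / knu ->
  0 <= aS <= 1 -> aS * K_of d aS = jnu / knu ->
  (* hypothesis (1) *)
  (exists (n : nat) (x : nat -> R),
      x 0%nat = 0 /\ x (S n) = aI /\
      (forall i, (i <= n)%nat -> x i < x (S i)) /\
      (forall i, (1 <= i <= n)%nat ->
         f_nu d (knu * K_of d (x (S i)) * x (S i))
         + (K_of d (x i)) ^ d * f_nu d (knu * b_of d (x i)) <= 0) /\
      G1 d knu (x 1%nat) + G2 d knu (x 0%nat) <= 0) ->
  (* hypothesis (2) *)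
  (exists (m : nat) (y : nat -> R),
      y 0%nat = aS /\ y (S m) = 1 /\
      (forall i, (i <= m)%nat -> y i < y (S i)) /\
      (forall i, (i < m)%nat ->
         f_nu d (knu * K_of d (y (S i)) * y (S i))
         + f_nu d (knu * b_of d (y i)) <= 0) /\
      2 * T1 d (y m)
      - f_nu d (knu * b_of d (y m)) * Rabs (g_nu d (knu * K_of d (y m) * y m))
        * ((INR d - 1) / (y m) ^ d * (1 + / b_of d (y m)) + 1)
      - f_nu d (knu * b_of d (y m)) * g_nu d (knu * b_of d (y m)) >= 0) ->
  forall a : R, (0 <= a < aI) \/ (aS < a <= 1) ->
    F_nu d knu a <= 0.
Proof.
  intros Hd Hj Hk HaI EaI HaS EaS [n [x [Hx0 [Hxn [Hx [Hxc HG]]]]]]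
    [m [y [Hy0 [Hym [Hy [Hyc HT]]]]]] a [Ha|Ha].
  (* Cell 0 is governed by the condition on G1 + G2, every later cell by its own endpoint
     inequality. *)
  - destruct (partition_locate x a n ltac:(lra)) as [[|i] [Hi Hai]].
    + rewrite Hx0 in Hai, HG. destruct Hai as [[Ha0|Ha0] Ha1].
      * pose proof (partition_monotone x n 1 (S n) Hx ltac:(lia) ltac:(lia)).
        apply (F_nu_le_first_cell d jnu knu aI) with (x 1%nat); trivial; lra.
      * subst a. rewrite F_nu_0; [lra | easy | exact Hk].
    + pose proof (partition_monotone x n (S (S i)) (S n) Hx ltac:(lia) ltac:(lia)).
      pose proof (partition_monotone x n 1 (S i) Hx ltac:(lia) ltac:(lia)).
      pose proof (Hx 0%nat ltac:(lia)).
      apply (F_nu_le_lower_cell d jnu knu aI) with (x (S i)) (x (S (S i))); trivial; try lra.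
      apply Hxc. lia.
  (* The located cells are half-open, so a = 1 is settled apart. *)
  - destruct (Rle_lt_or_eq_dec a 1 ltac:(lra)) as [Ha1|Ha1];
      [|subst a; rewrite F_nu_1; [lra | easy | exact Hk]].
    destruct (partition_locate y a m ltac:(lra)) as [i [Hi Hai]].
    pose proof (partition_monotone y m 0 i Hy ltac:(lia) ltac:(lia)).
    destruct (Nat.eq_dec i m) as [Him|Him].
    + subst i. apply (F_nu_le_last_cell d jnu knu aI aS) with (y m); trivial; try lra.
      apply (last_condition d jnu knu aI aS); trivial; lra.
    + pose proof (partition_monotone y m (S i) (S m) Hy ltac:(lia) ltac:(lia)).
      apply (F_nu_le_upper_cell d jnu knu aI aS) with (y i) (y (S i)); trivial; try lra.
      apply Hyc. lia.
Qed.
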